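(* Let $0<\beta<1$. Let $Y_0$ be an exponential random variable with density $e^{-x}$, $x\ge 0$, and let $Y_\beta$ be a positive random variable, independent of $Y_0$, following the $M$-Wright distribution with parameter $\beta$, i.e. having density $M_\beta(t)$, $t\ge 0$. Then $$Y_{0}\overset{\mathcal{L}}{=}Y_{0}^{\beta}\,Y_{\beta}.$$
   Context: $\overset{\mathcal{L}}{=}$ denotes equality in law. For $0<\beta<1$, the $M$-Wright function is the entire function $$M_{\beta}(z):=\sum_{n=0}^{\infty}\frac{(-z)^{n}}{n!\,\Gamma(1-\beta(n+1))},$$ with the convention $1/\Gamma(x)=0$ when $x\in\{0,-1,-2,\dots\}$. It is a known fact that $M_\beta$ is nonnegative on $[0,\infty)$ and integrates to $1$ there, so it is a probability density on $[0,\infty)$. *)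

(* Defs.v *)
From HB Require Import structures.
From mathcomp Require Import all_boot all_order all_algebra.
From mathcomp Require Import lra.
From mathcomp Require Import all_classical all_reals all_analysis.
From mathcomp Require Import measurable_realfun.

Set Implicit Arguments.
Unset Strict Implicit.
Unset Printing Implicit Defensive.

Import Order.TTheory GRing.Theory Num.Theory.
Import numFieldNormedType.Exports.

Local Open Scope classical_set_scope.
Local Open Scope ring_scope.

Section Gamma.
Context {R : realType}.
Implicit Types x : R.

Definition Gamma_integral x : R :=
  \int[lebesgue_measure]_(t in `]0, +oo[) (t `^ (x - 1) * expR (- t)).

(* The least natural number m such that 0 < x + m. *)
Definition Gamma_shift x : nat :=
  if 0 < x then 0%N else (Num.truncn (- x)).+1.

(* The Gamma function on the real line: for x <= 0 it is obtained from the
   integral by iterating Gamma x = Gamma (x + 1) / x.  At the poles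
   0, -1, -2, ... one factor of the product vanishes, so that Gamma x = 0
   because 0^-1 = 0; hence (Gamma x)^-1 = 0 there, which is the usual
   convention for the reciprocal Gamma function. *)
Definition Gamma x : R :=
  Gamma_integral (x + (Gamma_shift x)%:R) /
  \prod_(k < Gamma_shift x) (x + k%:R).

Lemma Gamma_shift_gt0 x : 0 < x + (Gamma_shift x)%:R.
Proof.
rewrite /Gamma_shift; case: ifPn => [x0|]; first by rewrite addr0.
rewrite -leNgt => x0; rewrite addrC -[x in _ + x]opprK subr_gt0.
exact: truncnS_gt.
Qed.

Lemma Gamma_gt0E x : 0 < x -> Gamma x = Gamma_integral x.
Proof. by move=> x0; rewrite /Gamma /Gamma_shift x0 big_ord0 addr0 divr1. Qed.

Lemma Gamma_pole n : Gamma (- n%:R) = 0.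
Proof.
rewrite /Gamma /Gamma_shift oppr_gt0 ltrn0 opprK natrK.
by rewrite big_ord_recr /= addNr mulr0 invr0 mulr0.
Qed.

Lemma Gamma_rec x : x <= 0 -> Gamma x = Gamma (x + 1) / x.
Proof.
move=> x0; have [->|xN0] := eqVneq x 0.
  by rewrite invr0 mulr0; have := Gamma_pole 0; rewrite oppr0.
have S : Gamma_shift x = (Gamma_shift (x + 1)).+1.
  rewrite {1}/Gamma_shift ltNge x0 /=; congr _.+1; rewrite /Gamma_shift.
  have [x1|x1] := ltP 0 (x + 1); first by apply/truncn_def; lra.
  have nx : 0 <= - (x + 1) by rewrite oppr_ge0.
  have := truncn_itv nx; set n := Num.truncn _; move=> h.
  by apply/truncn_def; move: h; rewrite -!natr1; lra.
rewrite /Gamma S big_ord_recl /= addr0 -natr1 invfM.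
under eq_bigr do rewrite /bump /= natrD addrA.
set p := \prod_(i < _) _; rewrite -mulrA [p^-1 / x]mulrC.
by congr (Gamma_integral _ * _); rewrite -addrA [1 + _]addrC.
Qed.

Definition M_Wright (beta z : R) : R :=
  limn [series (- z) ^+ n / (n`!%:R * Gamma (1 - beta * n.+1%:R))]_n.

Definition M_Wright_pdf (beta : R) : R -> R := M_Wright beta \_ `[0, +oo[.

End Gamma.

Section laws.
Context {d : measure_display} {T : measurableType d} {R : realType}.
Variable P : probability T R.
Implicit Types X Y : {mfun T >-> R}.

Definition has_density X (f : R -> R) : Prop :=
  [/\ measurable_fun setT f,
      forall x, 0 <= f x &
      forall A, measurable A ->
        distribution P X A = (\int[lebesgue_measure]_(x in A) (f x)%:E)%E].

Definition independent_RV2 X Y : Prop :=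
  forall A B : set R, measurable A -> measurable B ->
    P (X @^-1` A `&` Y @^-1` B) = (P (X @^-1` A) * P (Y @^-1` B))%E.

(* Measures are total functions on sets, with unconstrained values on the
   non-measurable ones, so laws are only compared on measurable sets. *)
Definition eq_in_law X Y : Prop :=
  forall A, measurable A -> distribution P X A = distribution P Y A.

End laws.

Section power.
Context {d : measure_display} {T : measurableType d} {R : realType}.
Implicit Type X : {mfun T >-> R}.

(* The random variable X ^ a; its values are those of the usual power on the
   event 0 <= X. *)
Definition pow_RV X (a : R) : T -> R := fun w => X w `^ a.

Lemma measurable_pow_RV X a : measurable_fun setT (pow_RV X a).
Proof. exact: (measurableT_comp (measurable_powR a)). Qed.

HB.instance Definition _ X a :=
  isMeasurableFun.Build _ _ T R (pow_RV X a) (measurable_pow_RV X a).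

End power.

(* Main.v *)
Require Import Defs.
From HB Require Import structures.
From mathcomp Require Import all_boot all_order all_algebra.
From mathcomp Require Import ring lra.
From mathcomp Require Import all_classical all_reals all_analysis.
From mathcomp Require Import measurable_realfun.
Import Order.TTheory GRing.Theory Num.Theory.
Import numFieldNormedType.Exports.
Local Open Scope classical_set_scope.
Local Open Scope ring_scope.

Set Implicit Arguments.
Unset Strict Implicit.
Unset Printing Implicit Defensive.

(** Let S be a positive stable variable of index beta, that is
    E[exp (- s S)] = exp (- s ^ beta).  The M-Wright law is the law of
    S ^ (- beta), and this makes the theorem clear: if Y = S ^ (- beta) is
    independent of Y0, then
      P(Y0 ^ beta * Y > x) = P(Y0 > x ^ (1 / beta) * S)
                           = E[exp (- x ^ (1 / beta) * S)] = exp (- x).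
    What has to be found is the link between the power series M_beta and the
    Laplace transform of S.  The usual link is a contour integral; here it is
    a limit theorem for a random walk, so that everything stays real.

    Let S_n be a sum of n independent variables with the Sibuya law, the law
    on the positive integers whose generating function is 1 - (1 - z) ^ beta.
    Its distribution function and its transform are both explicit:
      P(S_n <= k)
        = sum_j binomial(n, j) (-1) ^ j [z ^ k] (1 - z) ^ (beta j - 1),
      sum_k P(S_n <= k) z ^ k = (1 - (1 - z) ^ beta) ^ n / (1 - z)
    (sibuya_cdf, sibuya_gf), and the first expression takes values in [0, 1]
    by a convolution recursion (sibuya_cdfS, sibuya_cdf_itv).

    Let k be of order n ^ (1 / beta).  The limit of Gauss,
      (k + 1) ^ a [z ^ k] (1 - z) ^ (a - 1) --> 1 / Gamma (1 - a),   a >= 0,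
    (cvg_binc_Gamma) turns the j-th term of P(S_n <= k) into
    (- y) ^ j / (j! Gamma (1 - beta j)); it produces the reciprocal Gamma
    function at negative arguments, with the value 0 at the poles.  A bound
    uniform in k (binc_bound) allows passing to the limit in the sum, hence
      P(S_n <= k) --> W(y) = sum_j (- y) ^ j / (j! Gamma (1 - beta j))
    (cvg_sibuya_wright).  On the other hand the transform of S_n, taken at
    z = exp (- 1 / N) with N = (n / x) ^ (1 / beta), gives
    (1 - (1 - z) ^ beta) ^ n --> exp (- x).  Together, by dominated
    convergence (integral_wright),
      int_0^oo exp (- u) W(x u ^ (- beta)) du = exp (- x).

    Finally W(0) = 1 and W' = - M_beta, so that W(y) = P(Ybeta > y)
    (wright_tail), and by independence the last integral is
    P(Y0 ^ beta * Ybeta > x) (product_tail).  The two sides of the theorem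
    have the same tails, hence the same law. *)

(** * Preliminaries: power series, the exponential, integrals of densities *)

Section calculus.
Context {R : realType}.

Lemma derivable_continuous (f : R -> R) (t : R) :
  derivable f t 1 -> {for t, continuous f}.
Proof.
by move=> ft; apply/differentiable_continuous/derivable1_diffP.
Qed.

Lemma continuous_expRN : continuous (fun t : R => expR (- t)).
Proof.
move=> t.
by apply: continuous_comp; [exact: continuousN|exact: continuous_expR].
Qed.

Lemma measurable_expRN : measurable_fun setT (fun t : R => expR (- t)).
Proof. by apply: measurableT_comp => //; exact: measurable_funN. Qed.

Lemma is_derive_NexpRN (t : R) :
  is_derive t (1 : R) (fun t : R => - expR (- t)) (expR (- t)).
Proof.
have h1 : is_derive t (1 : R) (fun t : R => - t) (- 1) by apply: is_deriveN.
have h2 := is_derive_expR (- t).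
have h3 := @is_derive1_comp R expR (fun t : R => - t) t _ _ h2 h1.
have h4 := is_deriveN h3.
by apply: is_derive_eq h4 _; rewrite mulrN1 opprK.
Qed.

Lemma exprn_fact_le_expR (x : R) n : 0 <= x -> x ^+ n / n`!%:R <= expR x.
Proof.
move=> x0; case: n => [|n].
  by rewrite expr0 fact0 divr1 -expR0 ler_expR.
by apply: le_trans (expR_ge1Dxn n x0); rewrite lerDr.
Qed.

Lemma integral_itvNy_restrict (f : R -> R) (y : R) :
  (\int[lebesgue_measure]_(t in `]-oo, y]) ((f \_ `[0%R, +oo[) t)%:E =
   \int[lebesgue_measure]_(t in `[0%R, y]) (f t)%:E)%E.
Proof.
have -> : `[0, y]%classic = `]-oo, y]%classic `&` `[0, +oo[%classic :> set R.
  apply/seteqP; split => z/=; rewrite !in_itv/= ?andbT; first by move=> /andP[].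
  by move=> [-> ->].
rewrite integral_mkcondr; apply: eq_integral => z _.
by rewrite !patchE; case: ifP.
Qed.

End calculus.

Section pseries.
Context {R : realType}.

(** With s the square root of |z| / |K|, the factor n.+1 is absorbed by one of
    the two copies of s ^+ n, because n.+1 * s ^+ n is at most the geometric
    sum 1 + s + ... + s ^+ n; the other copy provides convergence. *)
Lemma is_cvg_pseries_diffs (f : R^nat) (K z : R) :
  cvgn (pseries f K) -> `|z| < `|K| -> cvgn (pseries (pseries_diffs f) z).
Proof.
move=> /cvg_series_bounded[M [Mreal MP]] zK.
have K0 : 0 < `|K| by apply: le_lt_trans zK.
pose C := `|M| + 1; pose s := Num.sqrt (`|z| / `|K|).
have C0 : 0 <= C by rewrite addr_ge0.
have fC n : `|f n| * `|K| ^+ n <= C.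
  rewrite -normrX -normrM; apply: MP => //.
  by rewrite (le_lt_trans (ler_norm _))// ltrDl.
have s0 : 0 <= s by exact: sqrtr_ge0.
have sz : `|z| = s ^+ 2 * `|K|.
  by rewrite sqr_sqrtr ?divr_ge0// divfK ?gt_eqF.
have s1 : s < 1.
  by rewrite -sqrtr1 ltr_sqrt// ltr_pdivrMr// mul1r.
apply: normed_cvg.
apply: (@series_le_cvg _ _ (geometric (C / `|K| / (1 - s)) s)).
- by move=> n /=.
- by move=> n; rewrite /geometric/= mulr_ge0 ?exprn_ge0// !divr_ge0// subr_ge0
    ltW.
- move=> n; rewrite /geometric/= /pseries_diffs !normrM normrX normr_nat sz
    exprMn -exprM.
  have geo : n.+1%:R * s ^+ n <= (1 - s)^-1.
    rewrite -[leRHS]mul1r ler_pdivlMr ?subr_gt0//.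
    have : \sum_(i < n.+1) s ^+ n <= \sum_(i < n.+1) s ^+ i.
      apply: ler_sum => i _; rewrite ler_wiXn2l// ?ltW//.
      by rewrite -ltnS.
    rewrite sumr_const card_ord => h.
    apply: (@le_trans _ _ ((\sum_(i < n.+1) s ^+ i) * (1 - s))).
      by rewrite ler_wpM2r ?subr_ge0 ?(ltW s1)// mulr_natl.
    have -> : (\sum_(i < n.+1) s ^+ i) * (1 - s) = 1 - s ^+ n.+1.
      by rewrite -[RHS]opprB subrX1; ring.
    by rewrite gerBl exprn_ge0.
  rewrite (_ : _ * _ = (`|f n.+1| * `|K| ^+ n.+1) / `|K| *
      ((n.+1%:R * s ^+ n) * s ^+ n)); last first.
    by rewrite exprS mul2n -addnn exprD; field; rewrite gt_eqF.
  rewrite -[leRHS]mulrA ler_pM ?mulr_ge0 ?invr_ge0 ?exprn_ge0//.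
    by rewrite ler_wpM2r ?invr_ge0.
  by rewrite ler_wpM2r ?exprn_ge0.
- by apply: is_cvg_geometric_series; rewrite ger0_norm.
Qed.

(** The differentiated series inherits convergence on the whole line, which
    is what allows differentiating the sum of an entire series repeatedly. *)
Lemma is_cvg_entire_diffs (c : R^nat) : (forall x, cvgn (pseries c x)) ->
  forall x, cvgn (pseries (pseries_diffs c) x).
Proof.
move=> cc x; apply: is_cvg_pseries_diffs (cc (`|x| + 1)) _.
by rewrite [ltRHS]ger0_norm ?ltrDl// addr_ge0.
Qed.

Lemma is_derive_entire (c : R^nat) : (forall x, cvgn (pseries c x)) ->
  forall x : R, is_derive x (1 : R) (fun y => limn (pseries c y))
    (limn (pseries (pseries_diffs c) x)).
Proof.
move=> cc x; have cd := is_cvg_entire_diffs cc.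
apply: (@pseries_snd_diffs _ c (`|x| + 1)) => //.
  exact: (is_cvg_entire_diffs cd).
by rewrite [ltRHS]ger0_norm ?ltrDl// addr_ge0.
Qed.

End pseries.

Section density.
Context d (T : measurableType d) (R : realType).
Local Open Scope ereal_scope.

(** The density p agrees almost everywhere with the Radon-Nikodym
    derivative, because both have the same integral over every measurable
    set. *)
Lemma integral_density (mu : {sigma_finite_measure set T -> \bar R})
    (nu : {finite_measure set T -> \bar R}) (p f : T -> \bar R) :
  measurable_fun setT p -> (forall t, 0 <= p t) ->
  (forall A, measurable A -> nu A = \int[mu]_(t in A) p t) ->
  measurable_fun setT f -> (forall t, 0 <= f t) ->
  \int[nu]_t f t = \int[mu]_t (f t * p t).
Proof.
move=> mp p0 nuE mf f0.
have numu : nu `<< mu.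
  apply/null_content_dominatesP => A mA muA0; rewrite nuE//.
  by apply: null_set_integral => //; exact: measurable_funTS.
have mRN : measurable_fun setT (Radon_Nikodym_SigmaFinite.f nu mu).
  exact: measurable_int (Radon_Nikodym_SigmaFinite.f_integrable numu).
have RN0 := Radon_Nikodym_SigmaFinite.f_ge0 numu.
rewrite -(Radon_Nikodym_SigmaFinite.change_of_variables numu)//.
apply: ge0_ae_eq_integral => //.
- exact: emeasurable_funM.
- exact: emeasurable_funM.
- by move=> t _; rewrite mule_ge0.
- by move=> t _; rewrite mule_ge0.
have : ae_eq mu setT (Radon_Nikodym_SigmaFinite.f nu mu) p.
  apply: integral_ae_eq => //.
  - exact: Radon_Nikodym_SigmaFinite.f_integrable.
  - by move=> A _ mA; rewrite -Radon_Nikodym_SigmaFinite.f_integral// nuE.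
by apply: filterS => t h _; rewrite h.
Qed.

End density.

Section tails.
Context {R : realType}.
Local Open Scope ereal_scope.

Lemma measure_eq_tails (m1 m2 : {measure set (measurableTypeR R) -> \bar R}) :
  m1 setT < +oo ->
  (forall x : R, m1 `]x, +oo[%classic = m2 `]x, +oo[%classic) ->
  forall A, measurable A -> m1 A = m2 A.
Proof.
move=> m1fin mE A mA.
apply: (@measure_unique _ R (measurableTypeR R) (@RGenOInfty.G R)
  (fun k : nat => `](- k%:R)%R, +oo[%classic : set R)
  _ _ _ _ m1 m2 _ _ A mA) => //.
- exact: RGenOInfty.measurableE.
- move=> _ _ [x ->] [y ->]; exists (Num.max x y).
  apply/seteqP; split => z/=; rewrite !in_itv/= !andbT gt_max;
    first by case=> -> ->.
  by move/andP.
- by move=> k; eexists.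
- apply/seteqP; split => // z _; exists (Num.truncn (- z)).+1 => //=.
  by rewrite in_itv/= andbT ltrNl; exact: truncnS_gt.
- by move=> _ [x ->].
- by move=> k; apply: le_lt_trans m1fin; apply: le_measure; rewrite ?inE.
Qed.

End tails.

(** * Coefficients of (1 - z) ^ a *)

Section binomial_coefficients.
Context {R : realType}.
Implicit Types a x y : R.

(** The coefficient of z ^ k in (1 - z) ^ a, that is (-1) ^ k times the
    generalized binomial coefficient of a and k. *)
Definition binc a k : R := \prod_(i < k) ((i%:R - a) / i.+1%:R).

Lemma binc0r a : binc a 0 = 1.
Proof. exact: big_ord0. Qed.

Lemma bincS a k : k.+1%:R * binc a k.+1 = (k%:R - a) * binc a k.
Proof.
by rewrite /binc big_ord_recr/= mulrCA [X in _ * X]mulrC divfK ?pnatr_eq0//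
  mulrC.
Qed.

Lemma bincN1 k : binc (-1) k = 1.
Proof.
rewrite /binc big1// => i _.
by rewrite opprK -natr1 divff// natr1 pnatr_eq0.
Qed.

(** This is (1 - z) ^ x * (1 - z) ^ y = (1 - z) ^ (x + y) read on
    coefficients. It follows from bincS alone: multiply by k.+1 = i +
    (k.+1 - i) and apply bincS to one factor in each of the two resulting
    sums. *)
Lemma binc_vandermonde x y k :
  \sum_(i < k.+1) binc x i * binc y (k - i) = binc (x + y) k.
Proof.
elim: k => [|k IH]; first by rewrite big_ord1 !binc0r mulr1.
apply: (@mulfI _ k.+1%:R); first by rewrite pnatr_eq0.
rewrite bincS -IH !mulr_sumr.
pose u i := i%:R * binc x i * binc y (k.+1 - i).
pose v i := binc x i * ((k.+1 - i)%:R * binc y (k.+1 - i)).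
rewrite [LHS](_ : _ = \sum_(i < k.+2) u i + \sum_(i < k.+2) v i); last first.
  rewrite -big_split/=; apply: eq_bigr => i _.
  rewrite /u /v; have ik : (i <= k.+1)%N by rewrite -ltnS.
  by rewrite natrB//; ring.
have u0 : u 0 = 0 by rewrite /u !mul0r.
have vk : v k.+1 = 0 by rewrite /v subnn mul0r mulr0.
rewrite big_ord_recl u0 add0r [X in _ + X]big_ord_recr/= vk addr0 -big_split/=.
apply: eq_bigr => i _; rewrite /u /v /bump/= add1n subSS.
have ik : (i <= k)%N by rewrite -ltnS.
by rewrite bincS subSn// bincS natrB//; ring.
Qed.

(** Vandermonde with y = -1: all coefficients of (1 - z) ^ (-1) are 1. *)
Lemma sum_binc x k : \sum_(i < k.+1) binc x i = binc (x - 1) k.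
Proof.
by rewrite -binc_vandermonde; apply: eq_bigr => i _; rewrite bincN1 mulr1.
Qed.

End binomial_coefficients.

(** * Sums of independent Sibuya variables *)

Section sibuya.
Context {R : realType}.
Variable b : R.
Hypotheses (b0 : 0 < b) (b1 : b < 1).

(** P(S_n <= k), for S_n a sum of n independent Sibuya variables: the
    coefficient of z ^ k in (1 - (1 - z) ^ b) ^ n / (1 - z), expanded by the
    binomial formula. *)
Definition sibuya_cdf n k : R :=
  \sum_(j < n.+1) 'C(n, j)%:R * (-1) ^+ j * binc (b * j%:R - 1) k.

Lemma sibuya_pmf_ge0 k : 0 <= - binc b k.+1.
Proof.
elim: k => [|k IH].
  by rewrite /binc big_ord1 sub0r divr1 opprK ltW.
have k0 : 0 < k.+2%:R :> R by rewrite ltr0n.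
rewrite -(pmulr_rge0 _ k0) mulrN bincS -mulrN mulr_ge0// subr_ge0.
by rewrite (le_trans (ltW b1))// ler1n.
Qed.

Lemma binc_ge0 (x : R) k : x <= 0 -> 0 <= binc x k.
Proof.
move=> x0; apply: prodr_ge0 => i _; rewrite divr_ge0// subr_ge0.
by rewrite (le_trans x0) ?ler0n.
Qed.

(** Conditioning on the first summand, which equals i.+1 with probability
    - binc b i.+1. On coefficients this is the factorization (1 -
    (1 - z) ^ b) ^ n.+1 = (1 - (1 - z) ^ b) ^ n * (1 - (1 - z) ^ b). *)
Lemma sibuya_cdfS n k : sibuya_cdf n.+1 k =
  \sum_(i < k) - binc b i.+1 * sibuya_cdf n (k - i.+1).
Proof.
(* multiplication of the generating function by (1 - z) ^ b *)
have conv : \sum_(i < k.+1) binc b i * sibuya_cdf n (k - i) =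
    \sum_(j < n.+1) 'C(n, j)%:R * (-1) ^+ j * binc (b * j.+1%:R - 1) k.
  under eq_bigr do rewrite mulr_sumr.
  rewrite exchange_big/=; apply: eq_bigr => j _.
  rewrite [X in binc X k](_ : _ = b + (b * j%:R - 1)); last first.
    by rewrite -natr1; ring.
  rewrite -binc_vandermonde mulr_sumr; apply: eq_bigr => i _; ring.
have pascal : sibuya_cdf n.+1 k = sibuya_cdf n k -
    \sum_(j < n.+1) 'C(n, j)%:R * (-1) ^+ j * binc (b * j.+1%:R - 1) k.
  rewrite /sibuya_cdf big_ord_recl [in RHS]big_ord_recl/= -addrA.
  congr (_ + _); first by rewrite !bin0.
  under eq_bigr do rewrite /bump/= add1n binS natrD exprS mulrDl mulrDl.
  rewrite big_split/=; congr (_ + _); last first.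
    rewrite -sumrN; apply: eq_bigr => j _; ring.
  rewrite big_ord_recr/= bin_small// !mul0r addr0.
  apply: eq_bigr => j _; rewrite /bump/= add1n exprS; ring.
rewrite pascal -conv big_ord_recl/= binc0r mul1r subn0 opprD addrA subrr add0r.
by rewrite -sumrN; apply: eq_bigr => i _; rewrite /bump/= add1n mulNr.
Qed.

(** The recursion writes the next function as a combination of values of the
    previous one, with nonnegative weights of total mass at most 1 since
    their partial sums are 1 - binc (b - 1) k. *)
Lemma sibuya_cdf_itv n k : 0 <= sibuya_cdf n k <= 1.
Proof.
elim: n k => [|n IH] k.
  by rewrite /sibuya_cdf big_ord1 bin0 expr0 mulr0 sub0r bincN1 !mulr1 lexx
    ler01.
rewrite sibuya_cdfS; apply/andP; split.
  by apply: sumr_ge0 => i _; rewrite mulr_ge0 ?sibuya_pmf_ge0//;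
    case/andP: (IH (k - i.+1)%N).
apply: (@le_trans _ _ (\sum_(i < k) - binc b i.+1)).
  apply: ler_sum => i _; rewrite ler_piMr ?sibuya_pmf_ge0//.
  by case/andP: (IH (k - i.+1)%N).
rewrite sumrN; have := @binc_ge0 (b - 1) k;
  rewrite -sum_binc big_ord_recl/= binc0r.
under eq_bigr do rewrite /bump/= add1n.
rewrite subr_le0 (ltW b1) => /(_ isT); lra.
Qed.

End sibuya.

(** * Growth of the coefficients and the binomial series *)

Section bound.
Context {R : realType}.
Implicit Types a x y : R.

Lemma binc_le_fact a k : k%:R <= a -> `|binc (a - 1) k| <= a ^+ k / k`!%:R.
Proof.
elim: k => [|k IH] ka; first by rewrite binc0r normr1 expr0 fact0 divr1.
have k0 : 0 < k.+1%:R :> R by rewrite ltr0n.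
rewrite -natr1 in ka.
rewrite -(ler_pM2l k0) -[X in X * `|_|](gtr0_norm k0) -normrM bincS normrM.
rewrite (_ : k.+1%:R * _ = a * (a ^+ k / k`!%:R)); last first.
  rewrite factS natrM exprS; by field; rewrite nat1r !pnatr_eq0 -lt0n fact_gt0.
have kr0 : 0 <= k%:R :> R by [].
rewrite ler_pM//; last by apply: IH; lra.
by rewrite ler_norml; apply/andP; split; lra.
Qed.

(** Bernoulli's inequality (1 + 1 / m) ^ (- a) >= 1 - a / m; multiplied over
    consecutive values of m, the right-hand side telescopes. *)
Lemma powR_succ_ratio a m : 0 <= a -> 0 < m ->
  1 - a / m <= (m / (m + 1)) `^ a.
Proof.
move=> a0 m0; have m1 : 0 < m + 1 by lra.
rewrite /powR gt_eqF ?divr_gt0//.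
rewrite (le_trans _ (expR_ge1Dx _))// lerD2l lerNl -mulrN ler_wpM2l//.
rewrite -lnV ?posrE ?divr_gt0// invf_div mulrDl divff ?gt_eqF// mul1r.
by apply: le_ln1Dx; apply: lt_trans (_ : 0 < _); rewrite ?invr_gt0//; lra.
Qed.

(** As long as k <= a, the coefficient is at most a ^ k / k!, hence at most
    exp a. From there on its modulus decreases at least as fast as
    k.+1 ^ (- a) by powR_succ_ratio. It is important for the exchange of
    limit and sum that the bound depends explicitly on a. *)
Lemma binc_bound a k : 0 <= a ->
  `|binc (a - 1) k| * k.+1%:R `^ a <= expR a * (a + 1) `^ a.
Proof.
move=> a0.
have small j : j%:R <= a ->
    `|binc (a - 1) j| * j.+1%:R `^ a <= expR a * (a + 1) `^ a.
  move=> ja; rewrite ler_pM ?powR_ge0//.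
    by rewrite (le_trans (binc_le_fact _))// exprn_fact_le_expR.
  by rewrite ge0_ler_powR// ?nnegrE -?natr1; [rewrite natr1|lra|lra].
elim: k => [|k IH]; first exact: small.
have [/small//|ak] := leP k.+1%:R a.
apply: le_trans IH.
have k0 : 0 < k.+1%:R :> R by rewrite ltr0n.
have k1 : 0 < k.+2%:R :> R by rewrite ltr0n.
have -> : binc (a - 1) k.+1 = (1 - a / k.+1%:R) * binc (a - 1) k.
  apply: (@mulfI _ k.+1%:R); first by rewrite gt_eqF.
  by rewrite bincS -(natr1 k); field; rewrite natr1 gt_eqF.
rewrite normrM [X in X * _]mulrC -mulrA ler_wpM2l//.
rewrite ger0_norm; last by rewrite subr_ge0 ler_pdivrMr// mul1r ltW.
have := @powR_succ_ratio _ _ a0 k0; rewrite natr1 => h.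
rewrite -[in leRHS](divfK (lt0r_neq0 k1) k.+1%:R) [in leRHS]powRM ?divr_ge0//.
by rewrite ler_wpM2r ?powR_ge0.
Qed.

End bound.

Section binomial_series.
Context {R : realType}.

Lemma is_cvg_binomial_series (a z : R) : 0 <= a -> `|z| < 1 ->
  cvgn (pseries (binc (a - 1)) z).
Proof.
move=> a0 z1; apply: normed_cvg.
apply: (@series_le_cvg _ _ (geometric (expR a * (a + 1) `^ a) `|z|)) => //.
- by move=> n /=.
- by move=> n; rewrite /geometric/= !mulr_ge0 ?exprn_ge0 ?expR_ge0 ?powR_ge0.
- move=> n; rewrite /geometric/= normrM normrX ler_wpM2r ?exprn_ge0//.
  apply: le_trans (binc_bound n a0).
  have : 1 `^ a <= n.+1%:R `^ a by rewrite ge0_ler_powR// ?nnegrE// ler1n.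
  by rewrite powR1 => h; rewrite ler_peMr.
- by apply: is_cvg_geometric_series; rewrite normr_id.
Qed.

Lemma pseries_diffs_binc (x : R) k :
  pseries_diffs (binc x) k = - x * binc (x - 1) k.
Proof.
rewrite /pseries_diffs; elim: k => [|k IH].
  by rewrite bincS !binc0r sub0r.
have k0 : k.+1%:R != 0 :> R by rewrite pnatr_eq0.
apply: (mulfI k0).
rewrite bincS [RHS]mulrCA bincS !mulrA [_ * (k.+1%:R - _)]mulrC -[LHS]mulrA IH.
by rewrite -natr1; ring.
Qed.

Lemma bincB (x : R) k : binc (x - 1) k.+1 - binc (x - 1) k = binc x k.+1.
Proof. by rewrite -!sum_binc big_ord_recr/= addrAC subrr add0r. Qed.

Let F (a z : R) := limn (pseries (binc a) z).

Let cvgF (a z : R) : 0 <= a + 1 -> `|z| < 1 -> cvgn (pseries (binc a) z).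
Proof.
by move=> a0 z1; rewrite -(addrK 1 a); exact: is_cvg_binomial_series.
Qed.

(** This is (1 - z) ^ a = (1 - z) * (1 - z) ^ (a - 1), read on partial sums. *)
Let F_step (a z : R) : 0 <= a -> `|z| < 1 -> F a z = (1 - z) * F (a - 1) z.
Proof.
move=> a0 z1; apply/cvg_lim => //.
have c := cvgF (a := a - 1); rewrite subrK in c; have {}c := c z a0 z1.
rewrite -(cvg_shiftS (pseries _ _))/=.
rewrite mulrBl mul1r.
have -> : (fun n => pseries (binc a) z n.+1) =
    (fun n => pseries (binc (a - 1)) z n.+1 - z * pseries (binc (a - 1)) z n).
  apply/funext => n; rewrite /pseries /series/= !big_mkord.
  elim: n => [|n IH]; first by rewrite !big_ord1 big_ord0 !binc0r mulr0 subr0.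
  rewrite big_ord_recr/= IH -bincB [in RHS]big_ord_recr/=.
  by rewrite [X in _ = _ - z * X]big_ord_recr/= exprS; ring.
apply: cvgB.
  by rewrite (cvg_shiftS (pseries (binc (a - 1)) z)).
by apply: cvgMl_tmp.
Qed.

Let F_derive (a z : R) : 0 <= a -> `|z| < 1 ->
  is_derive z (1 : R) (F a) (- a * F (a - 1) z).
Proof.
move=> a0 z1; have z0 := normr_ge0 z.
(* three nested radii, since differentiating twice costs two of them *)
have [K [K' [K'' [zK [KK [KK' K1]]]]]] : exists K K' K'' : R,
    `|z| < `|K| /\ `|K| < `|K'| /\ `|K'| < `|K''| /\ `|K''| < 1.
  exists (`|z| + (1 - `|z|) / 4), (`|z| + (1 - `|z|) / 3),
    (`|z| + (1 - `|z|) / 2).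
  move: z0 z1; move: (`|z|) => r r0 r1; rewrite !ger0_norm; lra.
have c2 : cvgn (pseries (binc a) K'') by apply: cvgF => //; lra.
have c1 := is_cvg_pseries_diffs c2 KK'.
have c0 := is_cvg_pseries_diffs c1 KK.
have -> : - a * F (a - 1) z = limn (pseries (pseries_diffs (binc a)) z).
  apply/esym/cvg_lim => //.
  rewrite (_ : pseries _ _ = (fun n => - a * pseries (binc (a - 1)) z n)).
    by apply: cvgMl_tmp; apply: cvgF => //; rewrite subrK.
  apply/funext => n; rewrite /pseries /series/= mulr_sumr.
  by apply: eq_bigr => i _; rewrite pseries_diffs_binc mulrA.
apply: (@pseries_snd_diffs _ _ K) => //.
  by apply: cvgF; [lra|rewrite (lt_trans KK)// (lt_trans KK')].
by apply: is_cvg_pseries_inside c1 KK.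
Qed.

(** By F_step and F_derive, (1 - z) F' = - a F for the sum F of the series
    of (1 - z) ^ a, so that F(z) (1 - z) ^ (- a) is constant. Working first
    with the exponent a >= 0 and dividing by 1 - z afterwards reaches the
    exponents a - 1 >= -1 that are needed for distribution functions. *)
Lemma binomial_series (a z : R) : 0 <= a -> 0 < z < 1 ->
  pseries (binc (a - 1)) z @ \oo --> (1 - z) `^ (a - 1).
Proof.
move=> a0 /andP[z0 z1].
have nz1 : `|z| < 1 by rewrite gtr0_norm.
have -> : (1 - z) `^ (a - 1) = F (a - 1) z; last first.
  by apply: cvgF => //; rewrite subrK.
pose g (t : R) := F a t * (1 - t) `^ (- a).
have gD (t : R) : `|t| < 1 -> is_derive t (1 : R) g 0.
  move=> t1; have Ft := F_derive a0 t1.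
  have t1' : 0 < 1 - t by rewrite subr_gt0 (le_lt_trans (ler_norm t)).
  have h1 : is_derive t (1 : R) (fun t : R => 1 - t) (0 - 1).
    by apply: is_deriveB.
  have h2 := is_derive1_powR (- a) t1'.
  have /(is_deriveM Ft) h3 : is_derive t (1 : R) (fun t : R => (1 - t) `^ (- a))
      (- a * (1 - t) `^ (- a - 1) * (0 - 1)).
    exact: (@is_derive1_comp R (fun y : R => y `^ (- a))
      (fun t : R => 1 - t) t _ _ h2 h1).
  apply: is_derive_eq h3 _.
  rewrite /GRing.scale/= (F_step a0 t1) powRB ?powRr1 ?ltW//; last first.
    by rewrite (gt_eqF t1') implybT.
  by field; rewrite gt_eqF.
have [||c _] := @MVT R g (fun=> 0) 0 z z0.
- by move=> t /[!in_itv]/= /andP[t0 tz]; apply: gD;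
    rewrite gtr0_norm// (lt_trans tz).
- apply: derivable_within_continuous => t /[!in_itv]/= /andP[t0 tz].
  by apply: ex_derive; apply: gD; rewrite ger0_norm// (le_lt_trans tz).
rewrite mul0r => /eqP; rewrite subr_eq0 => /eqP.
have F0 : F a 0 = 1.
  apply/cvg_lim => //; rewrite -(cvg_shiftS (pseries _ _))/=.
  rewrite (_ : (fun n => _) = cst 1); first exact: cvg_cst.
  apply/funext => n; rewrite /pseries /series/= big_mkord big_ord_recl/=.
  by rewrite big1 ?addr0 ?expr0 ?mulr1 ?binc0r// => i _;
    rewrite exprS mul0r mulr0.
have z1' : 0 < 1 - z by rewrite subr_gt0.
rewrite /g F0 subr0 powR1 mulr1 powRN (F_step a0 nz1) => e.
rewrite powRB ?powRr1 ?ltW//; last by rewrite (gt_eqF z1') implybT.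
apply: (@mulIf _ ((1 - z) `^ a)^-1); first by rewrite invr_eq0 gt_eqF ?powR_gt0.
apply: (@mulfI _ (1 - z)); first by rewrite gt_eqF.
rewrite [RHS]mulrA e; field.
by rewrite !gt_eqF ?powR_gt0.
Qed.
End binomial_series.

Section sibuya_generating_function.
Context {R : realType}.
Variable b : R.
Hypotheses (b0 : 0 < b) (b1 : b < 1).

Lemma sibuya_gf n (z : R) : 0 < z < 1 ->
  series (fun k => sibuya_cdf b n k * z ^+ k) @ \oo -->
  (1 - (1 - z) `^ b) ^+ n / (1 - z).
Proof.
move=> /[dup] z01 /andP[z0 z1]; have z1' : 0 < 1 - z by rewrite subr_gt0.
have -> : (1 - (1 - z) `^ b) ^+ n / (1 - z) =
    \sum_(j < n.+1) 'C(n, j)%:R * (-1) ^+ j * (1 - z) `^ (b * j%:R - 1).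
  rewrite exprDn mulr_suml; apply: eq_bigr => j _.
  rewrite powRB ?powRr1 ?ltW//; last by rewrite (gt_eqF z1') implybT.
  rewrite powRrM powR_mulrn ?powR_ge0// expr1n mul1r -mulr_natl.
  by rewrite [in LHS]exprNn !mulrA.
rewrite (_ : series _ = (fun m => \sum_(j < n.+1)
    ('C(n, j)%:R * (-1) ^+ j * pseries (binc (b * j%:R - 1)) z m))); last first.
  apply/funext => m; rewrite /series/=.
  under [RHS]eq_bigr do rewrite /pseries /series/= mulr_sumr.
  rewrite [RHS]exchange_big/=; apply: eq_bigr => k _.
  by rewrite /sibuya_cdf mulr_suml; apply: eq_bigr => j _; rewrite mulrA.
apply: cvg_big => [|j _]; first exact: add_continuous.
by apply: cvgMl_tmp; apply: binomial_series; rewrite // mulr_ge0// ltW.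
Qed.

End sibuya_generating_function.

(** * Exchange of limit and sum *)

Section tannery.
Context {R : realType}.

(** Dominated convergence for series, with a number of terms that grows with
    n. *)
Lemma tannery (f : nat -> R^nat) (B l : R^nat) :
  (forall n j, `|f n j| <= B j) -> cvgn (series B) ->
  (forall j, f n j @[n --> \oo] --> l j) ->
  \sum_(j < n.+1) f n j @[n --> \oo] --> limn (series l).
Proof.
move=> fB cB fl.
have lB j : `|l j| <= B j.
  by apply: (cvgr_to_le (cvg_norm (fl j))); exact: nearW.
have B0 j : 0 <= B j by apply: le_trans (lB j).
have cl : cvgn (series l).
  by apply: normed_cvg; apply: series_le_cvg cB => n //=; exact: lB.
apply/cvgrPdist_le => e e0.
have e3 : 0 < e / 3 by rewrite divr_gt0.
have [N [lN BN]] : exists N, `|limn (series l) - series l N| <= e / 3 /\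
    limn (series B) - series B N <= e / 3.
  have [N1 _ h1] := (@cvgrPdist_le _ _ _ _ _ _ _).1 cl _ e3.
  have [N2 _ h2] := (@cvgrPdist_le _ _ _ _ _ _ _).1 cB _ e3.
  exists (maxn N1 N2); split; first by apply: h1; rewrite /= leq_maxl.
  by apply: le_trans (ler_norm _) _; apply: h2; rewrite /= leq_maxr.
have head : \sum_(0 <= j < N) f n j @[n --> \oo] --> series l N.
  rewrite /series/=.
  by apply: cvg_big => [|j _]; [exact: add_continuous|exact: fl].
have {}head := (@cvgrPdist_le _ _ _ _ _ _ _).1 head _ e3.
near=> n.
have Nn : (N <= n.+1)%N by apply: leqW; near: n; exact: nbhs_infty_ge.
have hd : `|series l N - \sum_(0 <= j < N) f n j| <= e / 3.
  by near: n; exact: head.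
rewrite -(big_mkord xpredT (f n)) (@big_cat_nat _ _ _ N)//=.
have tl : `|\sum_(N <= j < n.+1) f n j| <= e / 3.
  apply: (le_trans (ler_norm_sum _ _ _)); apply: le_trans BN.
  apply: (@le_trans _ _ (\sum_(N <= j < n.+1) B j)); first exact: ler_sum.
  rewrite -sub_series_geq// lerB//.
  apply: nondecreasing_cvgn_le => // i j ij.
  by rewrite -subr_ge0 sub_series_geq// sumr_ge0.
have -> : limn (series l) -
    (\sum_(0 <= j < N) f n j + \sum_(N <= j < n.+1) f n j)
  = (limn (series l) - series l N) + (series l N - \sum_(0 <= j < N) f n j)
    - \sum_(N <= j < n.+1) f n j by ring.
have -> : e = e / 3 + e / 3 + e / 3 by field.
apply: (le_trans (ler_normB _ _)); apply: lerD => //.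
by apply: (le_trans (ler_normD _ _)); apply: lerD.
Unshelve. all: by end_near. Qed.

End tannery.

Section summability.
Context {R : realType}.
Variable b : R.
Hypotheses (b0 : 0 < b) (b1 : b < 1).

(** The bound of binc_bound at the exponent a = b * j. *)
Definition wright_bound (j : nat) : R :=
  expR (b * j%:R) * (b * j%:R + 1) `^ (b * j%:R).

Lemma wright_bound_ge0 j : 0 <= wright_bound j.
Proof. by rewrite mulr_ge0 ?expR_ge0 ?powR_ge0. Qed.

(** Since (j + 1) ^ j <= exp (j + 1) * j!, the factor (b j + 1) ^ (b j) is
    at most a geometric term times j! ^ b. The series is thus dominated by
    one with general term D ^ j / j! ^ (1 - b), and b < 1 gives convergence. *)
Lemma is_cvg_wright_bound (y : R) : 0 <= y ->
  cvgn (series (fun j => y ^+ j * wright_bound j / j`!%:R)).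
Proof.
move=> y0.
have g0 : 0 < 1 - b by rewrite subr_gt0.
pose D := y * expR b * expR b; have D0 : 0 <= D by rewrite !mulr_ge0 ?expR_ge0.
(* E is chosen so that
   (E ^ j / j!) ^ (1 - b) = 2 ^ j * D ^ j / j! ^ (1 - b), where E ^ j / j!
   is at most exp E: the factor 2 leaves a geometric series *)
pose E := (2 * D) `^ (1 - b)^-1; have E0 : 0 <= E by rewrite powR_ge0.
have Eg : E `^ (1 - b) = 2 * D.
  by rewrite -powRrM mulVf ?gt_eqF// powRr1// mulr_ge0.
apply: (@series_le_cvg _ _ (geometric (expR b * expR E `^ (1 - b)) (1 / 2))).
- by move=> j /=; rewrite divr_ge0// mulr_ge0 ?exprn_ge0 ?wright_bound_ge0.
- by move=> j; rewrite /geometric/= !mulr_ge0 ?exprn_ge0 ?expR_ge0 ?powR_ge0//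
    invr_ge0.
- move=> j; rewrite /geometric/=.
  have f0 : 0 < j`!%:R :> R by rewrite ltr0n fact_gt0.
  have wb : wright_bound j <= expR b * (expR b * expR b) ^+ j * j`!%:R `^ b.
    rewrite /wright_bound exprMn -!expRM_natr.
    have bj : b * j%:R + 1 <= j.+1%:R.
      by rewrite -natr1 lerD2r ler_piMl// ltW.
    have bj0 : 0 <= b * j%:R by rewrite mulr_ge0// ltW.
    have : j.+1%:R `^ (b * j%:R) <= (expR j.+1%:R * j`!%:R) `^ b.
      rewrite mulrC powRrM powR_mulrn//; apply: ge0_ler_powR.
      - exact: ltW.
      - by rewrite nnegrE exprn_ge0.
      - by rewrite nnegrE mulr_ge0 ?expR_ge0.
      by rewrite -ler_pdivrMr// exprn_fact_le_expR.
    rewrite powRM ?expR_ge0 ?ler0n// -expRM => h.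
    have : (b * j%:R + 1) `^ (b * j%:R) <= j.+1%:R `^ (b * j%:R).
      by rewrite ge0_ler_powR// ?nnegrE// addr_ge0.
    move=> /le_trans/(_ h) {}h.
    apply: (le_trans (ler_wpM2l (expR_ge0 _) h)).
    rewrite -natr1 [_ * b]mulrC mulrDr mulr1 expRD le_eqVlt; apply/orP; left.
    by apply/eqP; ring.
  apply: (@le_trans _ _ (expR b * (1 / 2) ^+ j * (E ^+ j / j`!%:R) `^ (1 - b))).
    rewrite powRM ?invr_ge0 ?exprn_ge0 ?(ltW f0)//.
    have -> : (E ^+ j) `^ (1 - b) = (2 * D) ^+ j.
      by rewrite -powR_mulrn// powRAC Eg powR_mulrn// mulr_ge0.
    have -> : j`!%:R^-1 `^ (1 - b) = j`!%:R `^ b / j`!%:R.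
      transitivity (j`!%:R `^ (b - 1) : R).
        by rewrite -powR_inv1 ?ltW// -powRrM; congr (_ `^ _); ring.
      rewrite powRB; last by rewrite (gt_eqF f0) implybT.
      by rewrite powRr1 ?ltW.
    rewrite 2![in leRHS]mulrA ler_wpM2r ?invr_ge0 ?(ltW f0)//.
    apply: (le_trans (ler_wpM2l (exprn_ge0 j y0) wb)).
    rewrite le_eqVlt; apply/orP; left; apply/eqP.
    rewrite /D !exprMn exprVn expr1n; field.
    by rewrite expf_neq0.
  rewrite mulrAC ler_wpM2r ?exprn_ge0 ?divr_ge0//.
  rewrite ler_wpM2l ?expR_ge0//; apply: ge0_ler_powR.
  - exact: ltW.
  - by rewrite nnegrE divr_ge0 ?exprn_ge0 ?(ltW f0).
  - by rewrite nnegrE expR_ge0.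
  exact: exprn_fact_le_expR.
- by apply: is_cvg_geometric_series; rewrite ger0_norm; lra.
Qed.

End summability.

(** * The Gamma integral and the limit of Gauss *)

Section gamma.
Context {R : realType}.
Notation mu := (@lebesgue_measure R).

(** The Gamma integral as an extended real number: its functional equation
    holds before finiteness is known, and finiteness for small x is deduced
    from it. *)
Definition gamma_int (x : R) : \bar R :=
  (\int[mu]_(t in `]0%R, +oo[) (t `^ (x - 1) * expR (- t))%:E)%E.

Lemma powR_le_expR (x t : R) : 0 < x -> 0 <= t ->
  t `^ x <= (2 * x) `^ x * expR (t / 2).
Proof.
move=> x0 t0; have x20 : 0 < 2 * x by rewrite mulr_gt0.
have t2 : 0 <= t / (2 * x) by rewrite divr_ge0// ltW.
rewrite [in leLHS](_ : t = (2 * x) * (t / (2 * x))); last first.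
  by rewrite mulrC divfK ?gt_eqF.
rewrite powRM ?(ltW x20)// ler_wpM2l ?powR_ge0//.
rewrite [X in expR X](_ : _ = (t / (2 * x)) * x); last by field; rewrite gt_eqF.
rewrite expRM; apply: ge0_ler_powR; rewrite ?nnegrE ?expR_ge0 ?(ltW x0)//.
by rewrite (le_trans _ (expR_ge1Dx _))// lerDr.
Qed.

Lemma measurable_gamma_integrand (x : R) (D : set R) :
  measurable_fun D (fun t : R => (t `^ (x - 1) * expR (- t))%:E).
Proof.
apply/measurable_funTS/measurable_EFinP; apply: measurable_funM.
  exact: measurable_powR.
exact: measurable_expRN.
Qed.

Lemma gamma_integrand_ge0 (x t : R) : 0 <= t `^ (x - 1) * expR (- t).
Proof. by rewrite mulr_ge0 ?powR_ge0 ?expR_ge0. Qed.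

(** For x > 1 the only difficulty is at infinity, where powR_le_expR
    compares the integrand with exp (- t / 2). *)
Lemma gamma_int_lty_gt1 (x : R) : 1 < x -> (gamma_int x < +oo)%E.
Proof.
move=> x1; have x0 : 0 < x - 1 by rewrite subr_gt0.
pose C := (2 * (x - 1)) `^ (x - 1) * 2.
apply: (@le_lt_trans _ _
    (\int[mu]_(t in `]0%R, +oo[) ((C * exponential_pdf (1 / 2) t)%:E))%E).
  apply: ge0_le_integral => //=.
  - by move=> t _; rewrite lee_fin gamma_integrand_ge0.
  - exact: measurable_gamma_integrand.
  - apply/measurable_funTS/measurable_EFinP; apply: measurable_funM => //.
    exact: measurable_exponential_pdf.
  - move=> t; rewrite in_itv/= andbT => t0;
      rewrite lee_fin exponential_pdfE ?(ltW t0)//.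
    rewrite (_ : C * _ = (2 * (x - 1)) `^ (x - 1) * expR (t / 2) * expR (- t)).
      by rewrite ler_wpM2r ?expR_ge0// powR_le_expR// ltW.
    rewrite -mulrA -expRD mulrA /C; by congr (_ * expR _); field.
under eq_integral do rewrite EFinM.
rewrite ge0_integralZl//=.
- rewrite lte_mul_pinfty//.
    by rewrite lee_fin mulr_ge0 ?powR_ge0.
  apply: (@le_lt_trans _ _ (\int[mu]_t (exponential_pdf (1 / 2) t)%:E)%E).
    apply: ge0_subset_integral => //=.
      by apply/measurable_EFinP; exact: measurable_exponential_pdf.
    by move=> t _; rewrite lee_fin exponential_pdf_ge0.
  by rewrite integral_exponential_pdf ?ltry.
- by apply/measurable_funTS/measurable_EFinP; exact: measurable_exponential_pdf.
- by move=> t _; rewrite lee_fin exponential_pdf_ge0.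
- by rewrite lee_fin mulr_ge0 ?powR_ge0.
Qed.

(** Segments exhausting the open half-line, on which one may integrate by
    parts although the integrand can be unbounded near 0. *)
Let gseg (n : nat) : set R := `[n.+1%:R^-1, n.+2%:R]%classic.

Let gseg_bigcup : \bigcup_n gseg n = `]0%R, +oo[%classic.
Proof.
apply/seteqP; split => [t [n _]|t].
  rewrite /gseg /= !in_itv/= andbT => /andP[+ _].
  by apply: lt_le_trans; rewrite invr_gt0.
rewrite /= in_itv/= andbT => t0.
have tV0 : 0 <= t^-1 + t by apply: addr_ge0; rewrite ?invr_ge0; apply: ltW.
exists (Num.truncn (t^-1 + t)) => //; rewrite /gseg /= in_itv/=.
have /andP[_ h] := truncn_itv tV0; have tV : 0 < t^-1 by rewrite invr_gt0.
apply/andP; split.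
  rewrite -[leRHS]invrK ler_pV2 ?inE ?unitfE ?gt_eqF ?ltr0n//=.
  by apply: (le_trans _ (ltW h)); rewrite lerDl; apply: ltW.
apply: (@le_trans _ _ (t^-1 + t)); first by rewrite lerDr; apply: ltW.
by apply: (le_trans (ltW h)); rewrite ler_nat.
Qed.

Let gseg_nd : nondecreasing_seq gseg.
Proof.
apply/nondecreasing_seqP => n; rewrite subsetEset => t;
  rewrite /gseg /= !in_itv/=.
move=> /andP[nt tn]; apply/andP; split.
  by apply: le_trans nt; rewrite lef_pV2 ?posrE ?ler_nat.
by apply: le_trans tn _; rewrite ler_nat.
Qed.

Let gamma_seg_cvg (x : R) :
  ((\int[mu]_(t in gseg n) (t `^ (x - 1) * expR (- t))%:E)%E @[n --> \oo] -->
  gamma_int x)%classic.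
Proof.
rewrite /gamma_int -gseg_bigcup.
apply: ge0_nondecreasing_set_cvg_integral => //.
- by move=> i; rewrite /gseg.
- by move=> i; exact: measurable_gamma_integrand.
- by move=> i t _; rewrite lee_fin gamma_integrand_ge0.
Qed.

Let gamma_by_parts (x : R) n : 0 < x ->
  (\int[mu]_(t in gseg n) (t `^ x * expR (- t))%:E =
  (n.+1%:R^-1 `^ x * expR (- n.+1%:R^-1) - n.+2%:R `^ x * expR (- n.+2%:R))%:E +
  x%:E * \int[mu]_(t in gseg n) (t `^ (x - 1) * expR (- t))%:E)%E.
Proof.
move=> x0; set a := n.+1%:R^-1; set c := n.+2%:R.
have a0 : 0 < a by rewrite invr_gt0.
have ac : a < c.
  by rewrite (@le_lt_trans _ _ 1) ?invf_le1 ?ler1n// ltr1n.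
have pos t : t \in `[a, c] -> 0 < t.
  by rewrite in_itv/= => /andP[at_ _]; exact: lt_le_trans at_.
have dpow (y t : R) : 0 < t -> derivable (fun t : R => t `^ y) t 1.
  by move=> t0; have h := is_derive1_powR y t0; exact: ex_derive.
have LR (f : R -> R) : (forall t, 0 < t -> derivable f t 1) ->
    derivable_oo_LRcontinuous f a c.
  move=> df; split => [t /subset_itv_oo_cc/pos/df//||].
  - by apply/cvg_at_right_filter/derivable_continuous/df.
  - by apply/cvg_at_left_filter/derivable_continuous/df; rewrite (lt_trans a0).
have within (f : R -> R) : (forall t, 0 < t -> derivable f t 1) ->
    {within `[a, c]%classic, continuous f}.
  by move=> df; apply: derivable_within_continuous => t /pos/df.
have dpowE (t : R) : 0 < t ->
    is_derive t (1 : R) (fun t : R => t `^ x) (x * t `^ (x - 1)).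
  by move=> t0; exact: is_derive1_powR.
have dNexp (t : R) : derivable (fun t : R => - expR (- t)) t 1.
  exact: (@ex_derive _ _ _ _ _ _ _ (is_derive_NexpRN t)).
have dexpN (t : R) : derivable (fun t : R => expR (- t)) t 1.
  have /derivableN := dNexp t; rewrite (_ : - _ = (fun t : R => expR (- t)))//.
  by apply/funext => r /=; rewrite /GRing.opp/= opprK.
rewrite /gseg -/a -/c.
rewrite (@integration_by_parts _ (fun t => t `^ x) (fun t => - expR (- t))
   (fun t => x * t `^ (x - 1)) (fun t => expR (- t)) _ _ ac).
- congr (_ + _)%E; first by congr EFin; ring.
  under eq_integral do rewrite mulrN -mulrA EFinN EFinM.
  rewrite integral_ge0N ?oppeK.
    rewrite ge0_integralZl//; first exact: measurable_gamma_integrand.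
    - by move=> t _; rewrite lee_fin gamma_integrand_ge0.
    - by rewrite lee_fin ltW.
  by move=> t _; rewrite -EFinM lee_fin mulr_ge0 ?gamma_integrand_ge0 ?(ltW x0).
- by apply: within => t t0; apply: derivableM => //; exact: dpow.
- by apply: LR => t t0; exact: dpow.
- move=> t /subset_itv_oo_cc/pos t0; rewrite derive1E.
  by have [_ ->] := dpowE _ t0.
- by apply: within.
- by apply: LR.
- by move=> t _; rewrite derive1E; have [_ ->] := is_derive_NexpRN t.
Qed.

Let boundary_cvg0 (x : R) : 0 < x ->
  (n.+1%:R^-1 `^ x * expR (- n.+1%:R^-1) -
    n.+2%:R `^ x * expR (- n.+2%:R) : R) @[n --> \oo] --> (0 : R).
Proof.
move=> x0; rewrite -(subr0 0); apply: cvgB.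
  apply: (@squeeze_cvgr _ _ _ _ (fun=> 0) (fun n => n.+1%:R^-1 `^ x)).
  - apply: nearW => n; rewrite mulr_ge0 ?powR_ge0 ?expR_ge0//=.
    by rewrite ler_piMr ?powR_ge0// expR_le1 oppr_le0 invr_ge0.
  - exact: cvg_cst.
  - apply: (cvg_at_rightP _ _ _).1 (powR_cvg0 x0) _ _; split => [n|].
      by rewrite invr_gt0.
    exact: cvg_harmonic.
pose C : R := (2 * x) `^ x.
apply: (@squeeze_cvgr _ _ _ _ (fun=> 0) (fun n =>
  C * (expR (- (2^-1))) ^+ n.+2)).
- apply: nearW => n; rewrite mulr_ge0 ?powR_ge0 ?expR_ge0//=.
  rewrite -expRM_natl.
  rewrite (_ : n.+2%:R * - 2^-1 = n.+2%:R / 2 - n.+2%:R :> R); last by field.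
  rewrite expRD mulrA ler_wpM2r ?expR_ge0//.
  by rewrite powR_le_expR.
- exact: cvg_cst.
- under eq_fun do rewrite !exprS.
  rewrite -(mulr0 C); apply: cvgMl_tmp.
  rewrite -(mulr0 (expR (- 2^-1))); apply: cvgMl_tmp.
  rewrite -(mulr0 (expR (- 2^-1))); apply: cvgMl_tmp.
  by apply: cvg_expr; rewrite ger0_norm ?expR_ge0// expR_lt1 oppr_lt0.
Qed.

Lemma gamma_int_rec (x : R) : 0 < x ->
  gamma_int (x + 1) = (x%:E * gamma_int x)%E.
Proof.
move=> x0; have := @gamma_seg_cvg (x + 1); rewrite addrK.
under eq_fun do rewrite gamma_by_parts//.
have h : (((n.+1%:R^-1 `^ x * expR (- n.+1%:R^-1) -
    n.+2%:R `^ x * expR (- n.+2%:R))%:E +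
  x%:E * \int[mu]_(t in gseg n) (t `^ (x - 1) * expR (- t))%:E) @[n --> \oo]
  --> 0%:E + x%:E * gamma_int x)%E.
  apply: cvgeD.
  - by rewrite fin_num_adde_defr.
  - by apply: cvg_EFin; [exact: nearW|exact: boundary_cvg0].
  - by apply: cvgeZl => //; exact: gamma_seg_cvg.
by move=> /cvg_unique/(_ h) ->//; rewrite add0e.
Qed.

(** The singularity at 0 for x < 1 is avoided by Gamma (x) = Gamma
    (x + 1) / x. *)
Lemma gamma_int_fin_num (x : R) : 0 < x -> gamma_int x \is a fin_num.
Proof.
move=> x0; have x1 : 1 < x + 1 by rewrite ltrDr.
have g0 : (0 <= gamma_int x)%E.
  by apply: integral_ge0 => t _; rewrite lee_fin gamma_integrand_ge0.
have := gamma_int_lty_gt1 x1; rewrite gamma_int_rec// ge0_fin_numE//.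
by case: (gamma_int x) g0 => [r| |]// _; rewrite ?ltry ?gt0_muley ?lte_fin.
Qed.

Lemma gamma_intE (x : R) : 0 < x -> gamma_int x = (Gamma_integral x)%:E.
Proof.
by move=> x0; rewrite /Gamma_integral /Rintegral fineK// gamma_int_fin_num.
Qed.

Lemma Gamma_integral_rec (x : R) : 0 < x ->
  Gamma_integral (x + 1) = x * Gamma_integral x.
Proof.
move=> x0; apply: EFin_inj; rewrite EFinM -!gamma_intE ?addr_gt0//.
exact: gamma_int_rec.
Qed.

(** A concave power lies below its tangent at c. *)
Lemma powR_le_tangent (a t c : R) : 0 <= a <= 1 -> 0 <= t -> 0 < c ->
  t `^ a <= c `^ a * (1 + a * (t / c - 1)).
Proof.
move=> /andP[a0 a1] t0 c0; have tc0 : 0 <= t / c by rewrite divr_ge0// ltW.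
rewrite [in leLHS](_ : t = c * (t / c)); last by rewrite mulrC divfK ?gt_eqF.
rewrite powRM ?(ltW c0)// ler_wpM2l ?powR_ge0//.
move: (t / c) tc0 => s s0.
have [->|sN0] := eqVneq s 0.
  rewrite /powR eqxx; case: (eqVneq a 0) => [->|_] /=; lra.
have {}s0 : 0 < s by rewrite lt_neqAle eq_sym sN0.
rewrite -(lnK s0); set x := ln s; rewrite -expRM mulrC.
(* With s = exp x, the claim exp (a x) <= a exp x + (1 - a) is the
   combination of h1 and h2 with weights a and 1 - a. *)
have h1 : expR (a * x) * (1 + (1 - a) * x) <= expR x.
  rewrite [in leRHS](_ : x = a * x + (1 - a) * x); last by ring.
  by rewrite expRD ler_wpM2l ?expR_ge0// expR_ge1Dx.
have h2 : expR (a * x) * (1 + - (a * x)) <= 1.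
  rewrite -[leRHS](expRxMexpNx_1 (a * x)).
  by rewrite ler_wpM2l ?expR_ge0// expR_ge1Dx.
nra.
Qed.

Lemma Gamma_integral1 : Gamma_integral 1 = 1 :> R.
Proof.
apply: EFin_inj; rewrite -gamma_intE// /gamma_int.
rewrite -(@integral_exponential_pdf R 1 ltr01).
have -> : (\int[mu]_t (exponential_pdf 1 t)%:E =
    \int[mu]_(t in `[0%R, +oo[) (t `^ (1 - 1) * expR (- t))%:E)%E.
  rewrite [RHS]integral_mkcond; apply: eq_integral => t _.
  rewrite /exponential_pdf !patchE; case: ifP => // _.
  by rewrite subrr powRr0 mulN1r.
by rewrite integral_itv_obnd_cbnd//; exact: measurable_gamma_integrand.
Qed.

Lemma Gamma_integral_fact k : Gamma_integral (k%:R + 1) = k`!%:R :> R.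
Proof.
elim: k => [|k IH]; first by rewrite add0r Gamma_integral1 fact0.
by rewrite Gamma_integral_rec// -natr1 IH factS natrM natr1.
Qed.

(** The form of log-convexity that is needed: integrate the tangent
    inequality of t ^ a at t = p, chosen so that the linear term integrates
    to 0. *)
Lemma Gamma_integral_shift_le (p a : R) : 0 < p -> 0 <= a <= 1 ->
  Gamma_integral (p + a) <= p `^ a * Gamma_integral p.
Proof.
move=> p0 /[dup] a01 /andP[a0 a1].
have pa0 : 0 < p + a by apply: ltr_wpDr.
rewrite -lee_fin EFinM -!gamma_intE//.
have -> : gamma_int p =
    ((1 - a)%:E * gamma_int p + (a / p)%:E * gamma_int (p + 1))%E.
  rewrite gamma_int_rec// !gamma_intE// -!EFinM -EFinD; congr EFin.
  by field; rewrite gt_eqF.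
have ap0 : 0 <= a / p by rewrite divr_ge0// ltW.
have a10 : 0 <= 1 - a by rewrite subr_ge0.
pose g y (t : R) := (t `^ (y - 1) * expR (- t))%:E.
have g0 y t : (0 <= g y t)%E by rewrite lee_fin gamma_integrand_ge0.
have mg y : measurable_fun (`]0%R, +oo[%classic : set R) (g y).
  exact: measurable_gamma_integrand.
have mcg c y : measurable_fun (`]0%R, +oo[%classic : set R)
    (fun t => c%:E * g y t)%E.
  exact: measurable_funeM.
rewrite /gamma_int -/(g p) -/(g (p + a)) -/(g (p + 1)).
rewrite -!ge0_integralZl ?lee_fin//;
  try solve [by move=> t _; exact: g0|exact: (mg p)|exact: (mg (p + 1))].
rewrite -ge0_integralD//;
  try solve [by move=> t _; rewrite mule_ge0 ?g0// lee_fin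
            |exact: (mcg _ p)|exact: (mcg _ (p + 1))].
rewrite -ge0_integralZl ?lee_fin ?powR_ge0//; last 2 first.
- by apply: emeasurable_funD; [exact: (mcg _ p)|exact: (mcg _ (p + 1))].
- by move=> t _; rewrite adde_ge0// mule_ge0 ?lee_fin ?gamma_integrand_ge0.
apply: ge0_le_integral => //.
- by move=> t _; rewrite lee_fin gamma_integrand_ge0.
- exact: mg.
- by apply: measurable_funeM; apply: emeasurable_funD;
    [exact: (mcg _ p)|exact: (mcg _ (p + 1))].
move=> t; rewrite /= in_itv/= andbT => t0; have tN0 : t != 0 by rewrite gt_eqF.
rewrite -[X in (_ <= _ * (X + _))%E]EFinM -[X in (_ <= _ * (_ + X))%E]EFinM.
rewrite -EFinD -EFinM lee_fin addrK.
rewrite (_ : p + a - 1 = (p - 1) + a); last by ring.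
rewrite powRD; last by rewrite tN0 implybT.
rewrite [in leRHS](_ : t `^ p = t `^ (p - 1) * t); last first.
  by rewrite -[X in _ * X]powRr1 ?(ltW t0)// -powRD ?subrK// tN0 implybT.
have := powR_le_tangent a01 (ltW t0) p0.
move=> /(ler_wpM2l (gamma_integrand_ge0 p t)).
rewrite (_ : _ * _ * expR _ = t `^ (p - 1) * expR (- t) * t `^ a); last by ring.
move=> /le_trans; apply; rewrite le_eqVlt; apply/orP; left; apply/eqP.
by field; rewrite gt_eqF.
Qed.

End gamma.

Section euler.
Context {R : realType}.
Implicit Types a : R.

Lemma Gamma_integral_gt0 a : 0 <= a < 1 -> 0 < Gamma_integral (1 - a).
Proof.
move=> /andP[a0 a1]; have a1' : 0 < 1 - a by rewrite subr_gt0.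
have := @Gamma_integral_shift_le _ _ a a1'; rewrite a0 (ltW a1) => /(_ isT).
rewrite subrK Gamma_integral1 => h.
by rewrite -(pmulr_rgt0 _ (powR_gt0 a a1')) (lt_le_trans _ h).
Qed.

(** Both sides satisfy the same recursion in k, by bincS and by the
    functional equation of Gamma. *)
Lemma Gamma_integral_binc a k : a < 1 ->
  binc (a - 1) k * k`!%:R * Gamma_integral (1 - a) =
  Gamma_integral (k.+1%:R - a).
Proof.
move=> a1; elim: k => [|k IH]; first by rewrite binc0r fact0 !mul1r.
have k0 : 0 <= k%:R :> R by [].
rewrite -(natr1 k.+1) addrAC Gamma_integral_rec; last by rewrite -natr1; lra.
rewrite -IH factS natrM.
transitivity ((k.+1%:R * binc (a - 1) k.+1) * k`!%:R * Gamma_integral (1 - a)).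
  by ring.
by rewrite bincS -natr1; ring.
Qed.

(** Log-convexity at p = k + 1 - a and at p = k + 1 encloses
    k.+1 ^ a * Gamma (k + 1 - a) / k! between 1 and (k + 1) / (k + 1 - a),
    and the latter is at most 1 + a / (1 - a) / (k + 1). *)
Let cvg_binc_lt1 a : 0 <= a < 1 ->
  k.+1%:R `^ a * binc (a - 1) k @[k --> \oo] --> (Gamma (1 - a))^-1.
Proof.
move=> /[dup] a01 /andP[a0 a1]; have G0 := Gamma_integral_gt0 a01.
rewrite Gamma_gt0E ?subr_gt0//; set G := Gamma_integral _ in G0 *.
have bE k : binc (a - 1) k = Gamma_integral (k.+1%:R - a) / k`!%:R * G^-1.
  rewrite -Gamma_integral_binc// -/G; field.
  by rewrite gt_eqF//= pnatr_eq0 -lt0n fact_gt0.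
rewrite -(mul1r G^-1); under eq_fun do rewrite bE mulrA.
apply: cvgMr_tmp.
apply: (@squeeze_cvgr _ _ _ _ (fun=> 1) (fun k =>
  1 + a / (1 - a) * harmonic k)).
- apply: nearW => k.
  have ka : 0 < k.+1%:R - a.
    by rewrite subr_gt0 (lt_le_trans a1)// ler1n.
  have f0 : 0 < k`!%:R :> R by rewrite ltr0n fact_gt0.
  have h1 := Gamma_integral_shift_le ka (introT andP (conj a0 (ltW a1))).
  rewrite subrK -natr1 Gamma_integral_fact natr1 in h1.
  have a1' : 0 <= 1 - a <= 1 by lra.
  have h2 := Gamma_integral_shift_le (ltr0Sn R k) a1'.
  have e : k.+1%:R + (1 - a) = k.+1%:R - a + 1 :> R by ring.
  rewrite e Gamma_integral_rec// -[in Gamma_integral k.+1%:R]natr1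
    Gamma_integral_fact in h2.
  have k0 : 0 < k.+1%:R `^ a :> R by rewrite powR_gt0.
  have k1 : 0 < k.+1%:R :> R by [].
  rewrite powRB ?powRr1// in h2; last by rewrite gt_eqF ?implybT.
  set g := Gamma_integral _ in h1 h2 *.
  apply/andP; split.
    rewrite mulrA ler_pdivlMr// mul1r (le_trans h1)//.
    rewrite ler_wpM2r//.
      by rewrite -(pmulr_rge0 _ (powR_gt0 a ka)) (le_trans _ h1)// ltW.
    by apply: ge0_ler_powR; rewrite ?nnegrE ?(ltW ka)// gerBl.
  rewrite mulrA ler_pdivrMr//.
  rewrite -(ler_pM2l ka) mulrCA.
  apply: le_trans (ler_wpM2l (ltW k0) h2) _.
  rewrite (_ : _ * _ = k.+1%:R * k`!%:R); last by field; rewrite gt_eqF.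
  rewrite mulrA ler_wpM2r ?(ltW f0)// /harmonic.
  rewrite -subr_ge0.
  have e2 : (k.+1%:R - a) * (1 + a / (1 - a) * k.+1%:R^-1) - k.+1%:R =
    a ^+ 2 / (1 - a) * (1 - k.+1%:R^-1).
    by field; rewrite !gt_eqF// subr_gt0.
  rewrite e2 mulr_ge0 ?divr_ge0 ?sqr_ge0 ?subr_ge0 ?(ltW a1)//.
  by rewrite invf_le1 ?ler1n.
- exact: cvg_cst.
- have : (1 + a / (1 - a) * harmonic k) @[k --> \oo] --> 1 + a / (1 - a) * 0.
    by apply: cvgD; [exact: cvg_cst|apply: cvgMl_tmp; exact: cvg_harmonic].
  by rewrite mulr0 addr0.
Qed.

(** For a >= 1 both sides are reduced to the exponent a - 1: on the right by
    Gamma (1 - a) = Gamma (2 - a) / (1 - a), on the left by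
    pseries_diffs_binc. Nothing special happens when 1 - a is a pole: the
    factor 1 - a, or the one met at a smaller exponent, makes both sides 0. *)
Lemma cvg_binc_Gamma a : 0 <= a ->
  k.+1%:R `^ a * binc (a - 1) k @[k --> \oo] --> (Gamma (1 - a))^-1.
Proof.
move=> a0; have := truncn_itv a0; move: (Num.truncn a) => m.
elim: m a a0 => [|m IH] a a0 am; first by apply: cvg_binc_lt1.
have a1 : 1 <= a by move/andP : am => [+ _]; apply: le_trans; rewrite ler1n.
have a10 : 0 <= a - 1 by rewrite subr_ge0.
have am' : m%:R <= a - 1 < m.+1%:R.
  by move: am; rewrite -[m.+2%:R]natr1 -[in X in X -> _]natr1; lra.
have {}IH := IH _ a10 am'.
have -> : (Gamma (1 - a))^-1 = (1 - a) * (Gamma (1 - (a - 1)))^-1.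
  rewrite Gamma_rec ?subr_le0// invfM invrK mulrC.
  by congr (_ * (Gamma _)^-1); ring.
pose h (k : nat) : R := 1 - a * harmonic k.
have h1 : h k @[k --> \oo] --> (1 : R).
  have : (1 - a * harmonic k) @[k --> \oo] --> 1 - a * 0.
    by apply: cvgB; [exact: cvg_cst|apply: cvgMl_tmp; exact: cvg_harmonic].
  by rewrite mulr0 subr0.
have uv k : k.+1%:R `^ a * binc (a - 1) k * h k =
    (1 - a) * (k.+1%:R `^ (a - 1) * binc (a - 1 - 1) k).
  have := pseries_diffs_binc (a - 1) k; rewrite /pseries_diffs bincS => e.
  have k0 : k.+1%:R != 0 :> R by rewrite pnatr_eq0.
  rewrite powRB ?powRr1//; last by rewrite k0 implybT.
  rewrite /h /harmonic/=; apply: (mulfI k0).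
  transitivity (k.+1%:R `^ a * ((k%:R - (a - 1)) * binc (a - 1) k)).
    by rewrite -natr1; field; rewrite natr1.
  by rewrite e; field.
have : (1 - a) * (k.+1%:R `^ (a - 1) * binc (a - 1 - 1) k) / h k
    @[k --> \oo] --> (1 - a) * (Gamma (1 - (a - 1)))^-1 / 1.
  apply: cvgM; first exact: cvgMl_tmp.
  by apply: cvgV => //; rewrite oner_eq0.
rewrite divr1; apply: cvg_trans; apply: near_eq_cvg.
have h0 : \forall k \near \oo, 0 < h k by apply: (cvgr_gt _ h1).
by near=> k; rewrite -uv mulfK// gt_eqF//; near: k.
Unshelve. all: by end_near. Qed.

Lemma Gamma_inv_bound a : 0 <= a ->
  `|(Gamma (1 - a))^-1| <= expR a * (a + 1) `^ a.
Proof.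
move=> a0; apply: (cvgr_to_le (cvg_norm (cvg_binc_Gamma a0))).
apply: nearW => k; rewrite normrM mulrC [X in _ * X <= _]ger0_norm ?powR_ge0//.
exact: binc_bound.
Qed.

End euler.

(** * The Wright function as a limit of distribution functions *)

Section falling_factorials.
Context {R : realType}.

Lemma bin_le_expn_fact n j : 'C(n, j)%:R <= n%:R ^+ j / j`!%:R :> R.
Proof.
have f0 : 0 < j`!%:R :> R by rewrite ltr0n fact_gt0.
rewrite ler_pdivlMr// -natrM bin_ffact -natrX ler_nat.
elim: j {f0} => [//|j IH]; rewrite ffactnSr expnSr leq_mul//; exact: leq_subr.
Qed.

Lemma cvg_bin_expn j : 'C(n, j)%:R / n%:R ^+ j @[n --> \oo] --> (j`!%:R^-1 : R).
Proof.
have f0 : j`!%:R != 0 :> R by rewrite pnatr_eq0 -lt0n fact_gt0.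
have -> : (fun n => 'C(n, j)%:R / n%:R ^+ j : R) =
    (fun n => (n ^_ j)%:R / n%:R ^+ j / j`!%:R).
  by apply/funext => n; rewrite -bin_ffact natrM mulrAC mulfK.
suff h : (n ^_ j)%:R / n%:R ^+ j @[n --> \oo] --> (1 : R).
  have := cvgM h (cvg_cst (j`!%:R^-1 : R)); rewrite mul1r; exact.
elim: j {f0} => [|j IH].
  by under eq_fun do rewrite ffactn0 expr0 divr1; exact: cvg_cst.
have h : (n - j)%:R / n%:R @[n --> \oo] --> (1 : R).
  rewrite -cvg_shiftS/=.
  have : 1 - j%:R * harmonic n @[n --> \oo] --> (1 - j%:R * 0 : R).
    by apply: cvgB; [exact: cvg_cst|apply: cvgMl_tmp; exact: cvg_harmonic].
  rewrite mulr0 subr0; apply: cvg_trans; apply: near_eq_cvg; near=> n.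
  have jn : (j <= n.+1)%N by apply: leqW; near: n; exact: nbhs_infty_ge.
  by rewrite natrB// mulrBl divff ?pnatr_eq0.
under eq_fun do rewrite ffactnSr natrM exprSr invfM mulrACA.
by have := cvgM IH h; rewrite mulr1; apply.
Unshelve. all: by end_near. Qed.

End falling_factorials.

Section wright.
Context {R : realType}.
Variable b : R.
Hypotheses (b0 : 0 < b) (b1 : b < 1).

Definition wright_coef (j : nat) : R := (j`!%:R * Gamma (1 - b * j%:R))^-1.

(** The Wright function W(- y; - b, 1); it turns out to be the survival
    function of the M-Wright law, see wright_tail. *)
Definition wright (y : R) : R := limn (pseries wright_coef (- y)).

Let bj0 j : 0 <= b * j%:R.
Proof. by rewrite mulr_ge0// ltW. Qed.

Lemma wright_coef_bound j : `|wright_coef j| <= wright_bound b j / j`!%:R.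
Proof.
have f0 : 0 < j`!%:R :> R by rewrite ltr0n fact_gt0.
rewrite /wright_coef invfM normrM mulrC.
rewrite [X in _ * X]ger0_norm ?invr_ge0 ?(ltW f0)//.
by rewrite ler_wpM2r ?invr_ge0 ?(ltW f0)//; exact: Gamma_inv_bound.
Qed.

Lemma is_cvg_wright (y : R) : cvgn (pseries wright_coef y).
Proof.
apply: normed_cvg.
apply: series_le_cvg (is_cvg_wright_bound b0 b1 (normr_ge0 y)).
- by move=> n /=.
- by move=> n; rewrite divr_ge0// mulr_ge0 ?exprn_ge0 ?wright_bound_ge0.
- move=> n /=; rewrite normrM normrX mulrC -mulrA ler_wpM2l ?exprn_ge0//.
  exact: wright_coef_bound.
Qed.

Lemma M_WrightE (y : R) :
  M_Wright b y = limn (pseries (pseries_diffs wright_coef) (- y)).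
Proof.
rewrite /M_Wright /pseries; congr (limn (series _)); apply/funext => n /=.
rewrite /pseries_diffs /wright_coef [RHS]mulrC; congr (_ * _).
by rewrite factS natrM -[X in _ = _ * X^-1]mulrA [in RHS]invfM mulVKf//
  pnatr_eq0.
Qed.

Lemma is_derive_wright (y : R) : is_derive y (1 : R) wright (- M_Wright b y).
Proof.
have h1 : is_derive y (1 : R) (fun t : R => - t) (- 1) by apply: is_deriveN.
have h2 := is_derive_entire is_cvg_wright (- y).
have h3 := @is_derive1_comp R (fun t => limn (pseries wright_coef t))
  (fun t : R => - t) y _ _ h2 h1.
by apply: is_derive_eq h3 _; rewrite mulrN1 M_WrightE.
Qed.

Lemma M_Wright_continuous : continuous (M_Wright b).
Proof.
move=> y; apply: derivable_continuous.
have h1 : is_derive y (1 : R) (fun t : R => - t) (- 1) by apply: is_deriveN.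
have h2 := is_derive_entire (is_cvg_entire_diffs is_cvg_wright) (- y).
have h3 := @is_derive1_comp R
  (fun t => limn (pseries (pseries_diffs wright_coef) t))
  (fun t : R => - t) y _ _ h2 h1.
rewrite (_ : M_Wright b =
  (fun t => limn (pseries (pseries_diffs wright_coef) t)) \o
  (fun t : R => - t)).
  exact: ex_derive.
by apply/funext => t; exact: M_WrightE.
Qed.

Lemma wright0 : wright 0 = 1.
Proof.
apply/cvg_lim => //; rewrite -(cvg_shiftS (pseries _ _))/=.
rewrite (_ : (fun n => _) = cst 1); first exact: cvg_cst.
apply/funext => n; rewrite /pseries /series/= big_mkord big_ord_recl/= oppr0.
rewrite big1 ?addr0 ?expr0 ?mulr1; last by move=> i _;
  rewrite exprS mul0r mulr0.
by rewrite /wright_coef mulr0 subr0 fact0 mul1r Gamma_gt0E// Gamma_integral1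
  invr1.
Qed.

(** The j-th term of sibuya_cdf is, up to sign, the product of
    'C(n, j) / n ^ j --> 1 / j!, of (n / (k + 1) ^ b) ^ j --> y ^ j, and of
    (k + 1) ^ (b j) * binc (b j - 1) k --> 1 / Gamma (1 - b j). The
    domination is binc_bound together with is_cvg_wright_bound. *)
Lemma cvg_sibuya_wright (k : nat -> nat) (y : R) :
  (forall n, n%:R / (k n).+1%:R `^ b <= y) ->
  n%:R / (k n).+1%:R `^ b @[n --> \oo] --> y ->
  k n @[n --> \oo] --> \oo ->
  sibuya_cdf b n (k n) @[n --> \oo] --> wright y.
Proof.
move=> ky nky koo.
have y0 : 0 <= y.
  by apply: le_trans (ky 0%N); rewrite mul0r.
apply: (@tannery _
  (fun n j => 'C(n, j)%:R * (-1) ^+ j * binc (b * j%:R - 1) (k n))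
  (fun j => y ^+ j * wright_bound b j / j`!%:R)).
- move=> n j; rewrite !normrM normrX normrN1 expr1n mulr1 ger0_norm//.
  have f0 : 0 < j`!%:R :> R by rewrite ltr0n fact_gt0.
  have k0 : 0 < (k n).+1%:R `^ b :> R by rewrite powR_gt0.
  apply: (le_trans (ler_wpM2r (normr_ge0 _) (bin_le_expn_fact _ _))).
  rewrite [leLHS](_ : _ = (n%:R / (k n).+1%:R `^ b) ^+ j *
     (`|binc (b * j%:R - 1) (k n)| * (k n).+1%:R `^ (b * j%:R)) / j`!%:R);
       last first.
    by rewrite powRrM powR_mulrn ?powR_ge0// expr_div_n; field;
      rewrite expf_neq0 ?gt_eqF.
  rewrite ler_wpM2r ?invr_ge0 ?(ltW f0)// ler_pM ?exprn_ge0 ?mulr_ge0 ?powR_ge0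
    ?divr_ge0//.
    by rewrite lerXn2r ?nnegrE ?divr_ge0 ?powR_ge0.
  exact: binc_bound.
- exact: is_cvg_wright_bound.
- move=> j.
  have h : (-1) ^+ j *
      ('C(n, j)%:R / n%:R ^+ j * (n%:R / (k n).+1%:R `^ b) ^+ j *
      ((k n).+1%:R `^ (b * j%:R) * binc (b * j%:R - 1) (k n))) @[n --> \oo] -->
      (-1) ^+ j * (j`!%:R^-1 * y ^+ j * (Gamma (1 - b * j%:R))^-1).
    apply: cvgMl_tmp; apply: cvgM.
      apply: cvgM; first exact: cvg_bin_expn.
      exact: (cvg_comp _ _ nky (@exprn_continuous R j y)).
    exact: (cvg_comp _ _ koo (cvg_binc_Gamma (bj0 j))).
  rewrite /= (_ : wright_coef j * (- y) ^+ j =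
    (-1) ^+ j * (j`!%:R^-1 * y ^+ j * (Gamma (1 - b * j%:R))^-1)); last first.
    rewrite /wright_coef [in LHS]exprNn invfM mulrCA; congr (_ * _).
    by rewrite mulrAC.
  move: h; apply: cvg_trans; apply: near_eq_cvg; near=> n.
  have n0 : (0 < n)%N by near: n; exact: nbhs_infty_gt.
  have k0 : 0 < (k n).+1%:R `^ b :> R by rewrite powR_gt0.
  rewrite powRrM powR_mulrn ?powR_ge0// expr_div_n; field.
  by rewrite !expf_neq0 ?gt_eqF ?ltr0n.
Unshelve. all: by end_near. Qed.

End wright.

(** * The integral identity for the Wright function *)

Section steps.
Context {R : realType}.
Notation mu := (@lebesgue_measure R).

Lemma integral_expRN_itv (a c : R) : a < c ->
  (\int[mu]_(u in `[a, c[) (expR (- u))%:E = (expR (- a) - expR (- c))%:E)%E.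
Proof.
move=> ac.
rewrite integral_itv_bndo_bndc; last first.
  by apply/measurable_EFinP/measurable_funTS; exact: measurable_expRN.
rewrite (@continuous_FTC2 _ _ (fun t => - expR (- t))) //.
- by rewrite -EFinB; congr EFin; ring.
- apply: continuous_subspaceT; exact: continuous_expRN.
- split.
  + by move=> t _; exact: (@ex_derive _ _ _ _ _ _ _ (is_derive_NexpRN t)).
  + by apply/cvg_at_right_filter; apply: cvgN; exact: continuous_expRN.
  + by apply/cvg_at_left_filter; apply: cvgN; exact: continuous_expRN.
- by move=> t _; rewrite derive1E; have [_ ->] := is_derive_NexpRN t.
Qed.

Variables (N : R) (g : nat -> R).
Hypotheses (N0 : 0 < N) (g0 : forall k, 0 <= g k).

Let F (k : nat) : set R := `[k%:R / N, k.+1%:R / N[%classic.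

Let F_trunc k u : F k u -> Num.truncn (u * N) = k.
Proof.
rewrite /F/= in_itv/= => /andP[ku uk]; apply/truncn_def.
by rewrite -ler_pdivrMr// ku -ltr_pdivlMr.
Qed.

Let F_bigcup : \bigcup_k F k = `[0, +oo[%classic.
Proof.
apply/seteqP; split => [u [k _]|u].
  rewrite /F/= !in_itv/= andbT => /andP[+ _]; apply: le_trans.
  by rewrite divr_ge0// ltW.
rewrite /= in_itv/= andbT => u0; exists (Num.truncn (u * N)) => //.
rewrite /F/= in_itv/= ler_pdivrMr// ltr_pdivlMr//.
by apply: truncn_itv; rewrite mulr_ge0// ltW.
Qed.

Let F_triv : trivIset setT F.
Proof. by move=> i j _ _ [u [/F_trunc <- /F_trunc <-]]. Qed.

Let mF k : measurable (F k). Proof. exact: measurable_itv. Qed.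

Definition step_integrand (u : R) : \bar R :=
  (expR (- u) * g (Num.truncn (u * N)))%:E.

Lemma measurable_step_integrand :
  measurable_fun (`[0%R, +oo[%classic : set R) step_integrand.
Proof.
rewrite -F_bigcup; apply/(measurable_fun_bigcup _ mF) => k.
apply: (eq_measurable_fun
  (fun u : measurableTypeR R => (expR (- u) * g k)%:E)).
  by move=> u /set_mem /F_trunc e; rewrite /step_integrand e.
apply/measurable_funTS/measurable_EFinP; apply: measurable_funM => //.
exact: measurable_expRN.
Qed.

(** Summation by pieces: on [k / N, k.+1 / N[ the integrand is a constant
    times exp (- u), so the integral is a power series evaluated at exp
    (- 1 / N). *)
Lemma integral_step (l : R) :
  series (fun k => g k * expR (- N^-1) ^+ k) @ \oo --> l ->
  (\int[mu]_(u in `[0%R, +oo[) step_integrand u =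
   ((1 - expR (- N^-1)) * l)%:E)%E.
Proof.
move=> gl; rewrite -F_bigcup ge0_integral_bigcup//=; last 2 first.
- by rewrite F_bigcup; exact: measurable_step_integrand.
- by move=> u _; rewrite lee_fin mulr_ge0 ?expR_ge0.
have e k : (\int[mu]_(u in F k) step_integrand u =
    (g k * expR (- N^-1) ^+ k * (1 - expR (- N^-1)))%:E)%E.
  transitivity (\int[mu]_(u in F k) ((g k)%:E * (expR (- u))%:E))%E.
    apply: eq_integral => u /set_mem/F_trunc e.
    by rewrite /step_integrand e -EFinM mulrC.
  rewrite ge0_integralZl//; last 3 first.
  - exact: mF.
  - by apply/measurable_EFinP/measurable_funTS; exact: measurable_expRN.
  - by rewrite lee_fin.
  rewrite integral_expRN_itv; last by rewrite ltr_pM2r ?invr_gt0// ltr_nat.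
  rewrite -EFinM; congr EFin; rewrite -mulrA; congr (_ * _).
  rewrite -!mulrN !expRM_natl exprS; ring.
apply: cvg_lim => //.
under eq_fun do (under eq_bigr do rewrite e); under eq_fun do rewrite sumEFin.
apply: cvg_EFin; first exact: nearW.
rewrite mulrC; rewrite (_ : _ \o _ =
  fun n => series (fun k => g k * expR (- N^-1) ^+ k) n * (1 - expR (- N^-1))).
  exact: cvgMr_tmp.
by apply/funext => n /=; rewrite /series/= mulr_suml.
Qed.

End steps.

Section exp_limit.
Context {R : realType}.

Lemma cvg_invn : n%:R^-1 @[n --> \oo] --> (0 : R).
Proof. by rewrite -cvg_shiftS; exact: cvg_harmonic. Qed.

(** From exp (- t / (1 - t)) <= 1 - t <= exp (- t). *)
Lemma cvg_exp_limit (t : R^nat) (x : R) :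
  (forall n, 0 <= t n <= 1) -> n%:R * t n @[n --> \oo] --> x ->
  (1 - t n) ^+ n @[n --> \oo] --> expR (- x).
Proof.
move=> t01 ntx.
have t0 : t n @[n --> \oo] --> (0 : R).
  have h : n%:R * t n * n%:R^-1 @[n --> \oo] --> (0 : R).
    by have := cvgM ntx cvg_invn; rewrite mulr0; apply.
  move: h; apply: cvg_trans; apply: near_eq_cvg; near=> n => /=.
  have n0 : (0 < n)%N by near: n; exact: nbhs_infty_gt.
  by rewrite mulrAC divff ?mul1r// pnatr_eq0 -lt0n.
have t1 : 1 - t n @[n --> \oo] --> (1 : R).
  by have := cvgB (cvg_cst (1 : R)) t0; rewrite subr0; apply.
have cexp (u : R^nat) (l : R) : u n @[n --> \oo] --> l ->
    expR (- u n) @[n --> \oo] --> expR (- l).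
  by move=> ul; exact: (cvg_comp _ _ ul (@continuous_expRN R l)).
apply: (@squeeze_cvgr _ _ _ _ (fun n => expR (- (n%:R * t n / (1 - t n))))
                       (fun n => expR (- (n%:R * t n)))).
- near=> n.
  have tn1 : 0 < 1 - t n by near: n; exact: (cvgr_gt _ t1).
  apply/andP; split; last first.
    rewrite -mulrN expRM_natl lerXn2r ?nnegrE ?expR_ge0 ?(ltW tn1)//.
    exact: expR_ge1Dx.
  rewrite -mulrA -mulrN expRM_natl lerXn2r ?nnegrE ?expR_ge0 ?(ltW tn1)//.
  rewrite expRN -[leRHS]invrK lef_pV2 ?posrE ?expR_gt0 ?invr_gt0//.
  apply: le_trans (expR_ge1Dx _).
  rewrite le_eqVlt; apply/orP; left; apply/eqP; field; exact: lt0r_neq0.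
- apply: cexp.
  have h : n%:R * t n / (1 - t n) @[n --> \oo] --> x / 1.
    by apply: cvgM => //; apply: cvgV => //; rewrite oner_eq0.
  by rewrite divr1 in h.
- exact: cexp.
Unshelve. all: by end_near. Qed.

End exp_limit.

Section scaling.
Context {R : realType}.
Variables (b x : R).
Hypotheses (b0 : 0 < b) (b1 : b < 1) (x0 : 0 < x).

(** The scale of the random walk: n steps have size of order n ^ (1 / b),
    and x is absorbed so that n / N n ^ b = x. *)
Let N (n : nat) : R := (n%:R / x) `^ b^-1.

Let N_powb n : N n `^ b = n%:R / x.
Proof. by rewrite -powRrM mulVf ?gt_eqF// powRr1// divr_ge0// ltW. Qed.

Let N_gt0 n : (0 < n)%N -> 0 < N n.
Proof. by move=> n0; rewrite powR_gt0// divr_gt0// ltr0n. Qed.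

Let N_cvgy : N n @[n --> \oo] --> +oo.
Proof.
apply/cvgryPge => A; near=> n.
have h : x * `|A| `^ b <= n%:R by near: n; exact: nbhs_infty_ger.
apply: (le_trans (ler_norm A)).
rewrite -[leLHS]powRr1// -(mulfV (lt0r_neq0 b0)) powRrM.
apply: ge0_ler_powR; rewrite ?nnegrE ?powR_ge0 ?invr_ge0 ?divr_ge0 ?(ltW x0)
  ?(ltW b0)//.
by rewrite ler_pdivlMr// mulrC.
Unshelve. all: by end_near. Qed.

Let cvg_Ninv : (N n)^-1 @[n --> \oo] --> (0 : R).
Proof.
apply/gtr0_cvgV0 => //; near=> n; apply: N_gt0; near: n; exact: nbhs_infty_gt.
Unshelve. all: by end_near. Qed.

(** The transform of the rescaled random walk tends to that of the stable
    law. *)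
Lemma sibuya_mass_cvg :
  (1 - (1 - expR (- (N n)^-1)) `^ b) ^+ n @[n --> \oo] --> expR (- x).
Proof.
have p1 : 1 `^ b = 1 :> R by rewrite powR1.
have Ni n : 0 <= (N n)^-1 by rewrite invr_ge0 powR_ge0.
have e1 n : 0 <= 1 - expR (- (N n)^-1) <= 1.
  by rewrite subr_ge0 expR_le1 oppr_le0 Ni/= gerBl expR_ge0.
apply: cvg_exp_limit => [n|].
  have /andP[? ?] := e1 n; rewrite powR_ge0 -[leRHS]p1/=.
  by apply: ge0_ler_powR; rewrite ?nnegrE ?(ltW b0).
apply: (@squeeze_cvgr _ _ _ _ (fun n => x / (1 + (N n)^-1)) (fun=> x)).
- near=> n.
  have n0 : (0 < n)%N by near: n; exact: nbhs_infty_gt.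
  have Nn := N_gt0 n0.
  have nE : n%:R = x * N n `^ b by rewrite N_powb mulrC divfK ?gt_eqF.
  rewrite nE -mulrA -powRM ?(ltW Nn)//; last by case/andP: (e1 n).
  set h := (N n)^-1 in e1 *; have h0 : 0 < h by rewrite invr_gt0.
  have Nh : N n = h^-1 by rewrite invrK.
  (* With h = 1 / N n, the quantity n * (1 - exp (- h)) ^ b equals
     x * ((1 - exp (- h)) / h) ^ b, where (1 - exp (- h)) / h lies between
     1 / (1 + h) and 1. *)
  have hE : 1 - expR (- h) <= h by rewrite lerBlDr -lerBlDl; exact: expR_ge1Dx.
  have e0 : 0 <= 1 - expR (- h) by case/andP: (e1 n).
  have r1 : N n * (1 - expR (- h)) <= 1 by rewrite -ler_pdivlMl// mulr1.
  have r0 : (1 + h)^-1 <= N n * (1 - expR (- h)).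
    rewrite -ler_pdivrMl// -/h.
    have : expR (- h) <= (1 + h)^-1.
      by rewrite expRN lef_pV2 ?posrE ?expR_gt0 ?expR_ge1Dx// addr_gt0.
    have -> : h * (1 + h)^-1 = 1 - (1 + h)^-1.
      by field; rewrite gt_eqF// addr_gt0.
    lra.
  have rp : 0 < N n * (1 - expR (- h)).
    by apply: lt_le_trans r0; rewrite invr_gt0 addr_gt0.
  apply/andP; split; last first.
    rewrite ger_pMr// -[leRHS]p1.
    by apply: ge0_ler_powR; rewrite ?nnegrE ?(ltW b0) ?(ltW rp).
  rewrite ler_wpM2l ?(ltW x0)// (le_trans r0)//.
  by apply: ger1_powR; rewrite ?rp ?r1 ?ltW.
- have h : x / (1 + (N n)^-1) @[n --> \oo] --> x / (1 + 0).
    apply: cvgMl_tmp; apply: cvgV; first by rewrite addr0 oner_eq0.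
    by apply: cvgD; [exact: cvg_cst|exact: cvg_Ninv].
  by rewrite addr0 divr1 in h.
- exact: cvg_cst.
Unshelve. all: by end_near. Qed.

Variable u : R.
Hypothesis u0 : 0 < u.
Let k n := Num.truncn (u * N n).

Let N_ge0 n : 0 <= N n. Proof. exact: powR_ge0. Qed.

Let k_itv n : (k n)%:R <= u * N n < (k n).+1%:R.
Proof. by apply: truncn_itv; rewrite mulr_ge0// ltW. Qed.

Let k_le n : n%:R / (k n).+1%:R `^ b <= x * u `^ (- b).
Proof.
have nE : n%:R = x * N n `^ b by rewrite N_powb mulrC divfK ?gt_eqF.
rewrite ler_pdivrMr ?powR_gt0// nE -mulrA ler_wpM2l ?(ltW x0)//.
rewrite powRN ler_pdivlMl ?powR_gt0// -powRM ?(ltW u0)//.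
apply: ge0_ler_powR; rewrite ?nnegrE ?mulr_ge0 ?(ltW u0) ?(ltW b0)//.
by case/andP: (k_itv n) => _ /ltW.
Qed.

Let k_cvgy : k n @[n --> \oo] --> \oo.
Proof.
apply/cvgnyPge => A; near=> n.
rewrite truncn_ge_nat; last by rewrite mulr_ge0// ltW.
rewrite -ler_pdivrMl//; near: n.
by move/cvgryPge : N_cvgy; apply.
Unshelve. all: by end_near. Qed.

Let k_cvg : n%:R / (k n).+1%:R `^ b @[n --> \oo] --> x * u `^ (- b).
Proof.
have h : N n / (k n).+1%:R @[n --> \oo] --> u^-1.
  apply: (@squeeze_cvgr _ _ _ _ (fun n => (u + (N n)^-1)^-1) (fun=> u^-1)).
  - near=> n.
    have n0 : (0 < n)%N by near: n; exact: nbhs_infty_gt.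
    have Nn := N_gt0 n0; have /andP[k1 k2] := k_itv n.
    have kp : 0 < (k n).+1%:R :> R by [].
    apply/andP; split.
      rewrite -[leRHS]invrK lef_pV2 ?posrE ?invr_gt0 ?divr_gt0 ?addr_gt0
        ?invr_gt0//.
      rewrite invf_div ler_pdivrMr// mulrDl mulVf ?gt_eqF//.
      by rewrite -natr1 lerD2r.
    by rewrite ler_pdivrMr// ler_pdivlMl// ltW.
  - have h : (u + (N n)^-1)^-1 @[n --> \oo] --> (u + 0)^-1.
      apply: cvgV; first by rewrite addr0 gt_eqF.
      by apply: cvgD; [exact: cvg_cst|exact: cvg_Ninv].
    by rewrite addr0 in h.
  - exact: cvg_cst.
have c : {for u^-1, continuous (fun y : R => y `^ b)}.
  apply: derivable_continuous.
  have ui : 0 < u^-1 by rewrite invr_gt0.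
  exact: (@ex_derive _ _ _ _ _ _ _ (is_derive1_powR b ui)).
have powV (z : R) : 0 <= z -> z^-1 `^ b = (z `^ b)^-1.
  by move=> z0; rewrite -powR_inv1// powRAC powR_inv1// powR_ge0.
have : x * (N n / (k n).+1%:R) `^ b @[n --> \oo] --> x * u^-1 `^ b.
  by apply: cvgMl_tmp; exact: (cvg_comp _ _ h c).
rewrite powV ?(ltW u0)// powRN.
under eq_fun do rewrite powRM ?invr_ge0// powV// N_powb mulrA.
by under eq_fun do rewrite [x * _]mulrC divfK ?(gt_eqF x0)//.
Unshelve. all: by end_near. Qed.

Lemma cvg_sibuya_scaled :
  sibuya_cdf b n (Num.truncn (u * N n)) @[n --> \oo] -->
  wright b (x * u `^ (- b)).
Proof. exact: (cvg_sibuya_wright b0 b1 k_le k_cvg k_cvgy). Qed.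

End scaling.

Section integral_identity.
Context {R : realType}.
Notation mu := (@lebesgue_measure R).
Variables (b x : R).
Hypotheses (b0 : 0 < b) (b1 : b < 1) (x0 : 0 < x).

Let N (n : nat) : R := (n.+1%:R / x) `^ b^-1.
Let f n := step_integrand (N n) (sibuya_cdf b n.+1).

Let N_gt0 n : 0 < N n.
Proof. by rewrite powR_gt0// divr_gt0// ltr0n. Qed.

Let f_ge0 n u : (0 <= f n u)%E.
Proof.
by rewrite lee_fin mulr_ge0 ?expR_ge0//;
  case/andP: (sibuya_cdf_itv b0 b1 n.+1 (Num.truncn (u * N n))).
Qed.

Let mf n : measurable_fun (`]0%R, +oo[%classic : set R) (f n).
Proof.
apply: measurable_funS (measurable_step_integrand _ (N_gt0 n)) => //.
by apply: subset_itvr; rewrite bnd_simp.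
Qed.

Let int_f n : (\int[mu]_(u in `]0%R, +oo[) f n u =
  ((1 - (1 - expR (- (N n)^-1)) `^ b) ^+ n.+1)%:E)%E.
Proof.
rewrite integral_itv_obnd_cbnd//.
have z01 : 0 < expR (- (N n)^-1) < 1.
  by rewrite expR_gt0 expR_lt1 oppr_lt0 invr_gt0 N_gt0.
have c0 k : 0 <= sibuya_cdf b n.+1 k.
  by case/andP: (sibuya_cdf_itv b0 b1 n.+1 k).
rewrite (integral_step (N_gt0 n) c0 (@sibuya_gf _ _ b0 n.+1 _ z01)); congr EFin.
by rewrite mulrCA mulfV ?mulr1// gt_eqF// subr_gt0; case/andP: z01.
Qed.

Let f_cvg u : 0 < u ->
  f n u @[n --> \oo] --> (expR (- u) * wright b (x * u `^ (- b)))%:E.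
Proof.
move=> u0; apply: cvg_EFin; first exact: nearW.
rewrite /comp/=; apply: cvgMl_tmp.
by have := cvg_sibuya_scaled b0 b1 x0 u0; rewrite -cvg_shiftS.
Qed.

(** The functions f n are exp (- u) times a distribution function of the
    rescaled walk: they are dominated by exp (- u), converge pointwise by
    cvg_sibuya_scaled, and have explicit integrals by integral_step and
    sibuya_gf. *)
Lemma integral_wright :
  (\int[mu]_(u in `]0%R, +oo[) (expR (- u) * wright b (x * u `^ (- b)))%:E =
  (expR (- x))%:E)%E.
Proof.
pose g u := (expR (- u) * wright b (x * u `^ (- b)))%:E.
have fg u : `]0, +oo[%classic u -> f n u @[n --> \oo] --> g u.
  by rewrite /= in_itv/= andbT; exact: f_cvg.
have [|||||_ _ h] := @dominated_convergence _ _ R mu _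
  (measurable_itv `]0%R, +oo[) f g (fun u => (expR (- u))%:E).
- exact: mf.
- by apply: emeasurable_fun_cvg fg; exact: mf.
- by apply: aeW => u; exact: fg.
- apply/integrableP; split.
    by apply/measurable_EFinP/measurable_funTS; exact: measurable_expRN.
  rewrite (_ : integral _ _ _ = gamma_int 1);
    first by rewrite ltey_eq gamma_int_fin_num.
  apply: eq_integral => u _.
  by rewrite gee0_abs ?lee_fin ?expR_ge0// subrr powRr0 mul1r.
- apply: aeW => u n _; rewrite gee0_abs ?f_ge0// lee_fin ler_piMr ?expR_ge0//.
  by case/andP: (sibuya_cdf_itv b0 b1 n.+1 (Num.truncn (u * N n))).
- have h2 : (\int[mu]_(u in `]0%R, +oo[) f n u @[n --> \oo] -->
    (expR (- x))%:E)%E.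
    under eq_fun do rewrite int_f.
    apply: cvg_EFin; first exact: nearW.
    by have := sibuya_mass_cvg b0 b1 x0; rewrite -cvg_shiftS.
  exact: (cvg_unique _ h h2).
Qed.

End integral_identity.

(** * Tails and laws *)

Section wright_tail.
Context d (T : measurableType d) (R : realType) (P : probability T R).
Variable Y : {RV P >-> R}.
Variable b : R.
Hypotheses (b0 : 0 < b) (b1 : b < 1).
Hypothesis dY : has_density P Y (M_Wright_pdf b).
Notation mu := (@lebesgue_measure R).

(** Since W is a primitive of - M_beta with W(0) = 1, the mass of [0, y] is
    1 - W(y); the total mass is 1 because P is a probability. *)
Lemma wright_tail (y : R) : 0 < y ->
  (distribution P Y `]y, +oo[ = (wright b y)%:E)%E.
Proof.
move=> y0; rewrite -/(ccdf Y y) ccdf_1_cdf /cdf.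
case: dY => _ _ ->; last exact: measurable_itv.
rewrite integral_itvNy_restrict.
have dW (t : R) :
    is_derive t (1 : R) (fun t : R => - wright b t) (M_Wright b t).
  by have := is_deriveN (is_derive_wright b0 b1 t); rewrite opprK.
have cW : continuous (fun t : R => - wright b t).
  by move=> t; apply: derivable_continuous;
    exact: (@ex_derive _ _ _ _ _ _ _ (dW t)).
rewrite (@continuous_FTC2 _ _ (fun t => - wright b t)) //.
- by rewrite -!EFinB wright0// opprK; congr EFin; ring.
- by apply: continuous_subspaceT; exact: M_Wright_continuous.
- split.
  + by move=> t _; exact: (@ex_derive _ _ _ _ _ _ _ (dW t)).
  + by apply/cvg_at_right_filter; exact: cW.
  + by apply/cvg_at_left_filter; exact: cW.
- by move=> t _; rewrite derive1E; have [_ ->] := dW t.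
Qed.

End wright_tail.

Section joint.
Context d (T : measurableType d) (R : realType) (P : probability T R).

(** The same function, with values in the line equipped with the measurable
    structure that carries the Lebesgue measure, so that its distribution
    and the Lebesgue measure live on one type. *)
Definition borel_RV (X : {RV P >-> R}) : T -> measurableTypeR R := X.

Let measurable_borel_RV X : measurable_fun setT (borel_RV X).
Proof. exact: (measurable_funP X). Qed.

HB.instance Definition _ X := isMeasurableFun.Build _ _ T (measurableTypeR R)
  (borel_RV X) (measurable_borel_RV X).

Definition joint_RV (X Y : {RV P >-> R}) :
    T -> (measurableTypeR R * measurableTypeR R)%type :=
  fun w => (borel_RV X w, borel_RV Y w).

Let measurable_joint_RV X Y : measurable_fun setT (joint_RV X Y).
Proof. exact: measurable_fun_pair. Qed.

HB.instance Definition _ X Y :=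
  isMeasurableFun.Build _ _ T (measurableTypeR R * measurableTypeR R)%type
  (joint_RV X Y) (measurable_joint_RV X Y).

Lemma joint_distribution (X Y : {RV P >-> R}) : independent_RV2 P X Y ->
  forall A, measurable A -> distribution P (joint_RV X Y) A =
  (distribution P (borel_RV X) \x distribution P (borel_RV Y))%E A.
Proof.
move=> XY A mA; apply/esym.
by apply: (product_measure_unique (m' := distribution P (joint_RV X Y))).
Qed.

End joint.

Section laws.
Context d (T : measurableType d) (R : realType) (P : probability T R).

Lemma eq_in_law_of_tails (X Z : {RV P >-> R}) :
  (forall x : R, distribution P X `]x, +oo[ = distribution P Z `]x, +oo[) ->
  eq_in_law P X Z.
Proof.
move=> XZ A mA.
apply: (@measure_eq_tails _ (distribution P (borel_RV X))
  (distribution P (borel_RV Z))) => //.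
by rewrite [ltLHS](_ : _ = 1%E) ?ltry//; exact: (probability_setT P).
Qed.

(** The tails at 1 / n.+1 already tend to 1. *)
Lemma tail_le0 (X : {RV P >-> R}) :
  (forall x : R, 0 < x -> distribution P X `]x, +oo[ = (expR (- x))%:E) ->
  forall x : R, x <= 0 -> distribution P X `]x, +oo[ = 1%E.
Proof.
move=> Xexp x x0; apply/eqP; rewrite eq_le probability_le1//=.
have h n : ((expR (- harmonic n))%:E <= distribution P X `]x, +oo[)%E.
  rewrite -Xexp; last by rewrite /harmonic/= invr_gt0.
  apply: le_measure; rewrite ?inE//.
  by apply: subset_itvr; rewrite bnd_simp (le_trans x0)// /harmonic/= invr_ge0.
have fX : distribution P X `]x, +oo[ \is a fin_num by exact: fin_num_measure.
rewrite -(fineK fX) lee_fin.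
have c : expR (- harmonic n) @[n --> \oo] --> (1 : R).
  rewrite -expR0 -oppr0.
  exact: (cvg_comp _ _ cvg_harmonic (@continuous_expRN R 0)).
apply: (cvgr_to_le c); apply: nearW => n.
by rewrite -lee_fin fineK.
Qed.

End laws.

Section final.
Context d (T : measurableType d) (R : realType) (P : probability T R).
Variables Y0 Y : {RV P >-> R}.
Variable b : R.
Hypotheses (b0 : 0 < b) (b1 : b < 1).
Hypothesis dY0 : has_density P Y0 (exponential_pdf 1).
Hypothesis dY : has_density P Y (M_Wright_pdf b).
Hypothesis indep : independent_RV2 P Y0 Y.
Notation mu := (@lebesgue_measure R).

Lemma exponential_tail (x : R) : 0 < x ->
  distribution P Y0 `]x, +oo[ = (expR (- x))%:E.
Proof.
move=> x0; rewrite -/(ccdf Y0 x) ccdf_1_cdf /cdf.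
case: dY0 => _ _ ->; last exact: measurable_itv.
have -> : (\int[mu]_(t in `]-oo, x]) (exponential_pdf 1 t)%:E)%E =
    exponential_prob 1 `[0, x].
  rewrite /exponential_prob integral_itvNy_restrict; apply: eq_integral => t.
  rewrite inE/= in_itv/= => /andP[t0 _].
  by rewrite exponential_pdfE.
by rewrite exponential_prob_itv0c// mulN1r -!EFinB subKr.
Qed.

(** Given Y0 = t > 0, the event t ^ b * Y > x is Y > x * t ^ (- b), of
    probability W(x * t ^ (- b)); integration over t is integral_wright. *)
Lemma product_tail (x : R) : 0 < x ->
  distribution P (pow_RV Y0 b \* Y) `]x, +oo[ = (expR (- x))%:E.
Proof.
move=> x0.
pose A : set (measurableTypeR R * measurableTypeR R) :=
  (fun p => p.1 `^ b * p.2) @^-1` `]x, +oo[%classic.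
have mh : measurable_fun setT
    (fun p : measurableTypeR R * measurableTypeR R => p.1 `^ b * p.2).
  apply: measurable_funM; last exact: measurable_snd.
  by apply: (measurableT_comp (measurable_powR b)); exact: measurable_fst.
have mA : measurable A by rewrite -[A]setTI; exact: mh.
transitivity (distribution P (joint_RV Y0 Y) A); first by [].
rewrite joint_distribution// /product_measure1.
case: (dY0) => mp p0 nuE.
rewrite (@integral_density _ _ _ mu _ (fun t => (exponential_pdf 1 t)%:E))//;
  last 2 first.
- exact/measurable_EFinP.
- exact: measurable_fun_xsection.
rewrite -(integral_wright b0 b1 x0).
transitivity (\int[mu]_(t in `[0%R, +oo[)
    (distribution P (borel_RV Y) (xsection A t) * (expR (- t))%:E))%E.
  rewrite [RHS]integral_mkcond; apply: eq_integral => t _.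
  rewrite /exponential_pdf !patchE; case: ifP => _;
    first by rewrite mul1r mulN1r.
  by rewrite mule0.
rewrite -integral_itv_obnd_cbnd; last first.
  apply: emeasurable_funM.
    by apply: measurable_funTS; exact: measurable_fun_xsection.
  by apply/measurable_EFinP/measurable_funTS; exact: measurable_expRN.
apply: eq_integral => t; rewrite inE/= in_itv/= andbT => t0.
rewrite EFinM muleC; congr (_ * _)%E.
have y0 : 0 < x * t `^ (- b) by rewrite mulr_gt0 ?powR_gt0.
rewrite -(wright_tail b0 b1 dY y0); congr (P (_ @^-1` _)).
apply/seteqP; split => y /=; rewrite !in_itv/= !andbT powRN ltr_pdivrMr
  ?powR_gt0//.
  by rewrite /xsection/= inE /A/= in_itv/= andbT mulrC.
by rewrite /xsection/= inE /A/= in_itv/= andbT mulrC.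
Qed.

End final.

Unset Implicit Arguments.

Theorem theorem2p2 (R : realType) (beta : R) (d : measure_display)
    (T : measurableType d) (P : probability T R) (Y0 Ybeta : {RV P >-> R}) :
  0 < beta -> beta < 1 ->
  has_density P Y0 (exponential_pdf 1) ->
  has_density P Ybeta (M_Wright_pdf beta) ->
  independent_RV2 P Y0 Ybeta ->
  eq_in_law P Y0 (pow_RV Y0 beta \* Ybeta).
Proof.
move=> b0 b1 dY0 dYb indep.
have tY0 := exponential_tail dY0.
have tZ := product_tail b0 b1 dY0 dYb indep.
apply: eq_in_law_of_tails => x; have [x0|x0] := leP x 0.
  by rewrite (tail_le0 tY0 x0) (tail_le0 tZ x0).
by rewrite tY0// tZ.
Qed.
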